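(* Let $n\ge2$, let $l\in[0,n-1]$, and let $\lambda=(n-l,1^l)$. As abelian groups, we have $$S^{\lambda,*}/S^\lambda\;\cong\;(\mathbb{Z}/l!\,\mathbb{Z})^{\binom{n-2}{l}}\oplus(\mathbb{Z}/n\cdot l!\,\mathbb{Z})^{\binom{n-2}{l-1}}\;.$$ Moreover, tuples $x$ and $y$ of elements of $S^\lambda$ that trigonalize the Gram matrix (in the sense defined in the context; in particular $x$ and $y$ are $\mathbb{Z}$-linear bases of $S^\lambda$) are given as follows. The tuple $y$ consists of the standard basis, ordered in such a manner that all elements without entry $n$ in the first column come before all elements with entry $n$ in the first column. The tuple $x=(x',x'')$ has $x'$ consisting of the elements $\langle n,b\rangle$, where $b\subseteq[2,n-1]$ runs over the increasingly ordered tuples of length $l$, with respective diagonal correspondent $\langle 1,b\rangle$ in $y$; and $x''$ consisting of the elements $\sum_{s\in[1,n-1]\setminus d}\langle s,d,n\rangle$, where $d\subseteq[2,n-1]$ runs over the increasingly ordered tuples of length $l-1$, with respective diagonal correspondent $\langle1,d,n\rangle$ in $y$.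
   Context: Notation: $[a,b]$ is the integral interval; $\binom{a}{b}=0$ unless $a\ge b\ge0$. Tuples have pairwise distinct entries, and are identified with their underlying sets where appropriate. Specht modules: a $\lambda$-tableau $[a]$ is a bijective filling of the diagram of $\lambda$ with $1,\dots,n$; a $\lambda$-tabloid $\{a\}$ is a tableau with unordered rows. $M^\lambda$ is the free $\mathbb{Z}$-module on the $\lambda$-tabloids, with $\mathcal{S}_n$ acting on entries, and with the bilinear form $(-,=)$ for which the tabloids are orthonormal. With $C_a$ the column stabilizer of $[a]$, the polytabloid is $\langle a\rangle=\sum_{\sigma\in C_a}\varepsilon_\sigma\{a\}\sigma$ ($\varepsilon_\sigma$ the sign). $S^\lambda\subseteq M^\lambda$ is the $\mathbb{Z}$-span of the polytabloids, with the restricted form $(-,=)$. The standard basis of $S^\lambda$ consists of the polytabloids $\langle a\rangle$ where $[a]$ has strictly increasing rows and columns. $S^{\lambda,*}/S^\lambda$ denotes the cokernel of $S^\lambda\to\mathrm{Hom}_{\mathbb{Z}}(S^\lambda,\mathbb{Z})$, $\xi\mapsto(\xi,-)$. For the hook partition $\lambda=(n-l,1^l)$, a polytabloid is determined by the tuple of entries in the first column read from top to bottom; for a tuple $b=(b_0,\dots,b_l)$ in $[1,n]$, $\langle b\rangle$ denotes the polytabloid with that first column. $\langle n,b\rangle$, $\langle s,d,n\rangle$ denote polytabloids belonging to the concatenated tuples. Trigonalizing: let $m=\mathrm{rk}_{\mathbb{Z}}S^\lambda$ and $G$ be the Gram matrix of $(-,=)$ with respect to a $\mathbb{Z}$-basis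 of $S^\lambda$. Tuples $x=(x_1,\dots,x_m)$, $y=(y_1,\dots,y_m)$ in $S^\lambda$ are said to trigonalize the Gram matrix if: (i) $(x_i,y_i)\ne0$ for all $i$; (ii) $(x_i,y_j)=0$ for $i>j$; (iii) $(x_i,y_i)$ divides $(x_i,y_j)$ for $i<j$; (iv) $(x_i,y_i)$ divides $(x_{i+1},y_{i+1})$ for $i\in[1,m-1]$; (v) $\prod_i(x_i,y_i)=\pm\det G$. The element $y_i$ is the diagonal correspondent of $x_i$. *)

(* Defs.v *)
From HB Require Import structures.
From mathcomp Require Import all_boot all_order all_fingroup all_algebra.
From mathcomp Require Import boolp functions.

Set Implicit Arguments.
Unset Strict Implicit.
Unset Printing Implicit Defensive.

Import GRing.Theory Num.Theory.

Local Open Scope ring_scope.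

(* Unlike nat subtraction and 'C(_, _), this makes (n - 2 choose -1) vanish. *)
Definition binz (a b : int) : nat :=
  if 0 <= b <= a then 'C(`|a|%N, `|b|%N) else 0%N.

Definition zmod_iso (U V : zmodType) : Prop :=
  exists f : {additive U -> V}, bijective f.

(* The ring 'Z_m of zmodp is nontrivial even for m = 1, hence this quotient. *)
Definition Zquot (m : nat) : zmodType := {ideal_quot (GRing.ZmodClosed.clone int (dvdz m) _)}.

Section Coker.
Variables (U V : zmodType) (f : {additive U -> V}).

Definition im_pred : pred V := fun v => `[< exists u, f u = v >].

Fact im_pred_zmod_closed : zmod_closed im_pred.
Proof.
split=> [|_ _ /asboolP[u <-] /asboolP[v <-]]; apply/asboolP.
  by exists 0; rewrite raddf0.
by exists (u - v); rewrite raddfB.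
Qed.
HB.instance Definition _ := GRing.isZmodClosed.Build V im_pred
  im_pred_zmod_closed.

Definition coker : zmodType := {ideal_quot (GRing.ZmodClosed.clone V im_pred _)}.
End Coker.

Section Dual.
Variable V : zmodType.

Definition additive_pred : pred (V -> int) :=
  fun f => `[< {morph f : u v / u + v} >].

Fact additive_pred_zmod_closed : zmod_closed additive_pred.
Proof.
split=> [|f g /asboolP Hf /asboolP Hg]; apply/asboolP => u v.
  by rewrite /= addr0.
by rewrite [LHS]/GRing.add /= /GRing.opp /= Hf Hg opprD addrACA.
Qed.
HB.instance Definition _ := GRing.isZmodClosed.Build (V -> int) additive_pred
  additive_pred_zmod_closed.

Definition Zdual := {f : V -> int | f \in additive_pred}.
HB.instance Definition _ := [isSub of Zdual for sval].
HB.instance Definition _ := [Choice of Zdual by <:].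
HB.instance Definition _ := [SubChoice_isSubZmodule of Zdual by <:].
End Dual.

Definition Zbasis (V : zmodType) (e : seq V) : Prop :=
  forall v : V, exists! c : {ffun 'I_(size e) -> int},
    v = \sum_(i < size e) e`_i *~ c i.

Definition gram (V : zmodType) (form : V -> V -> int) (e : seq V) :
    'M[int]_(size e) :=
  \matrix_(i, j) form e`_i e`_j.

Definition trigonalizes (V : zmodType) (form : V -> V -> int) (x y : seq V) :
    Prop :=
  exists e : seq V, let m := size e in
    [/\ Zbasis e, size x = m & size y = m] /\
    [/\ forall i, (i < m)%N -> form x`_i y`_i != 0,
        forall i j, (j < i < m)%N -> form x`_i y`_j = 0,
        forall i j, (i < j < m)%N -> (form x`_i y`_i %| form x`_i y`_j)%Z,
        forall i, (i.+1 < m)%N -> (form x`_i y`_i %| form x`_i.+1 y`_i.+1)%Z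
      & let p := \prod_(i < m) form x`_i y`_i in
        p = \det (gram form e) \/ p = - \det (gram form e)].

Section Specht.
(* A partition sh of n is given by the sequence of its parts. *)
Variables (n : nat) (sh : seq nat).

Definition cell :=
  {c : 'I_(size sh) * 'I_(head 0%N sh) | (c.2 < nth 0 sh c.1)%N}.
HB.instance Definition _ := SubType.on cell.
HB.instance Definition _ := Finite.on cell.

Definition row_of (c : cell) : 'I_(size sh) := (val c).1.
Definition col_of (c : cell) : 'I_(head 0%N sh) := (val c).2.

(* The element i of 'I_n stands for the letter i + 1 of [1, n]; see entry. *)
Definition tableau :=
  {a : {ffun cell -> 'I_n} | injectiveb a && [forall k, exists c, a c == k]}.
HB.instance Definition _ := SubType.on tableau.
HB.instance Definition _ := Finite.on tableau.

Definition entry (a : tableau) (c : cell) : nat := (val a c).+1.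

Definition standard (a : tableau) : bool :=
  [forall c, forall c',
     ((row_of c == row_of c') && (col_of c < col_of c')%N
        ==> (entry a c < entry a c')%N) &&
     ((col_of c == col_of c') && (row_of c < row_of c')%N
        ==> (entry a c < entry a c')%N)].

Definition rows (a : tableau) : {ffun 'I_(size sh) -> {set 'I_n}} :=
  [ffun r => [set val a c | c in [pred c | row_of c == r]]].

Definition tabloid :=
  {t : {ffun 'I_(size sh) -> {set 'I_n}} | [exists a, t == rows a]}.
HB.instance Definition _ := SubType.on tabloid.
HB.instance Definition _ := Finite.on tabloid.

Fact tabloid_of_subproof (a : tableau) : [exists a', rows a == rows a'].
Proof. by apply/existsP; exists a. Qed.
Definition tabloid_of (a : tableau) : tabloid :=
  exist _ (rows a) (tabloid_of_subproof a).

Fact tableau_act_subproof (a : tableau) (s : 'S_n) :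
  let b := [ffun c => s (val a c)] in
  injectiveb b && [forall k, exists c, b c == k].
Proof.
case: a => a /= /andP[/injectiveP ia /forallP sa]; apply/andP; split.
  by apply/injectiveP => c c'; rewrite !ffunE => /perm_inj /ia.
apply/forallP => k; have /existsP[c /eqP ac] := sa ((s^-1)%g k).
by apply/existsP; exists c; rewrite ffunE ac permKV.
Qed.
Definition tableau_act (a : tableau) (s : 'S_n) : tableau :=
  exist _ [ffun c => s (val a c)] (tableau_act_subproof a s).

Fact tabloid_act_subproof (t : tabloid) (s : 'S_n) :
  [exists a, [ffun r => s @: val t r] == rows a].
Proof.
case: t => t /= /existsP[a /eqP ->]; apply/existsP; exists (tableau_act a s).
apply/eqP/ffunP => r; rewrite !ffunE -imset_comp.
by apply: eq_imset => c; rewrite /= ffunE.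
Qed.
Definition tabloid_act (t : tabloid) (s : 'S_n) : tabloid :=
  exist _ [ffun r => s @: val t r] (tabloid_act_subproof t s).

Definition col_stab (a : tableau) : {set 'S_n} :=
  [set s : 'S_n | [forall j,
     let C := [set val a c | c in [pred c | col_of c == j]] in s @: C == C]].

Notation M := {ffun tabloid -> int}.

Definition tabloid_vec (t : tabloid) : M := [ffun t' => (t' == t)%:R].

Definition perm_form (u v : M) : int := \sum_t u t * v t.

Definition polytabloidM (a : tableau) : M :=
  \sum_(s in col_stab a)
    tabloid_vec (tabloid_act (tabloid_of a) s) *~ ((-1) ^+ s).

Definition specht_pred : pred M :=
  fun u => `[< exists c : {ffun tableau -> int},
                 u = \sum_a polytabloidM a *~ c a >].

Fact specht_zmod_closed : zmod_closed specht_pred.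
Proof.
split=> [|_ _ /asboolP[c ->] /asboolP[d ->]]; apply/asboolP.
  by exists 0; rewrite big1 // => a _; rewrite ffunE mulr0z.
exists (c - d); rewrite -sumrB; apply: eq_bigr => a _.
by rewrite !ffunE mulrzBr.
Qed.
HB.instance Definition _ := GRing.isZmodClosed.Build M specht_pred
  specht_zmod_closed.

Definition specht := {u : M | u \in specht_pred}.
HB.instance Definition _ := [isSub of specht for sval].
HB.instance Definition _ := [Choice of specht by <:].
HB.instance Definition _ := [SubChoice_isSubZmodule of specht by <:].

Definition specht_form (u v : specht) : int := perm_form (val u) (val v).

Fact polytabloid_subproof (a : tableau) : polytabloidM a \in specht_pred.
Proof.
apply/asboolP; exists [ffun b => (b == a)%:R].
rewrite (bigD1 a) //= ffunE eqxx mulr1z big1 ?addr0 // => b /negPf nba.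
by rewrite ffunE nba mulr0z.
Qed.
Definition polytabloid (a : tableau) : specht :=
  exist _ (polytabloidM a) (polytabloid_subproof a).

Fact to_dual_subproof (u : specht) : specht_form u \in @additive_pred specht.
Proof.
apply/asboolP => v w; rewrite /specht_form /perm_form -big_split; apply: eq_bigr => t _.
by rewrite ffunE mulrDr.
Qed.
Definition to_dual (u : specht) : Zdual specht :=
  exist _ (specht_form u) (to_dual_subproof u).

Fact to_dual_zmod_morphism : zmod_morphism to_dual.
Proof.
move=> u v; apply/val_inj/funext => w.
rewrite /= [RHS]/GRing.add /= /GRing.opp /= /specht_form /perm_form -sumrB.
by apply: eq_bigr => t _; rewrite !ffunE mulrBl.
Qed.
HB.instance Definition _ := GRing.isZmodMorphism.Build specht (Zdual specht)
  to_dual to_dual_zmod_morphism.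

Definition dual_quotient : zmodType := coker to_dual.

Definition has_first_col (a : tableau) (b : seq nat) : bool :=
  (size b == size sh) &&
  [forall c, (col_of c == 0 :> nat)
     ==> (onth b (row_of c) == Some (entry a c))].

Definition n_in_first_col (a : tableau) : bool :=
  [exists c, (col_of c == 0 :> nat) && (entry a c == n)].

End Specht.

Definition hook (n l : nat) : seq nat := (n - l)%N :: nseq l 1%N.

(* Two tableaux of hook shape with the same first column have the same         *)
(* polytabloid, so the choice made by [pick _ | _] is immaterial; the default  *)
(* 0 is only reached if b is not the first column of a tableau.                *)
Definition hook_polytabloid (n l : nat) (b : seq nat) : specht n (hook n l) :=
  if [pick a : tableau n (hook n l) | has_first_col a b] is Some a
  then polytabloid a else 0.

(* The length k is an integer: there is no tuple of length k = -1. *)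
Definition incr_tuple (n : nat) (k : int) : pred (seq nat) :=
  fun b => [&& (size b)%:Z == k, sorted ltn b
             & all (fun i => (2 <= i <= n - 1)%N) b].

Definition std_ordering n sh (T : seq (tableau n sh)) : Prop :=
  [/\ uniq T, T =i @standard n sh
    & pairwise (fun a a' => n_in_first_col a ==> n_in_first_col a') T].

(* Main.v *)
(** For the hook (n-l, 1^l), a tabloid is the injective tuple w of its l entries
    below the first row, and the polytabloid with first column b has at w the
    value det N, where N has a first row of ones and (w_r = b_j) as further
    entries.  Hence an element u of the Specht module is an alternating function
    of w whose sum over any one argument vanishes, and
      (<b>, u) = l! * \sum_i (-1)^i u(b without b_i).
    An alternating function with vanishing sums is determined by its values at
    the increasing tuples avoiding one fixed letter m, and <m, c> has the value
    (c = c') there; m = 1 gives the standard basis, and with respect to m = n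
    the tuple x is block unitriangular.  The terms of (<n, b>, <1, c>) other
    than l! * (b = c) see the letter n, so they vanish if c avoids n; summing
    (<s, d, n>, u) over s leaves n * l! * u(d, n).  So the matrix of the
    (x_i, y_j) has l! and n * l! on the diagonal, 0 below, and multiples of the
    diagonal entries above, from which the cokernel is read off. *)

Require Import Defs.
From HB Require Import structures.
From mathcomp Require Import all_boot all_order all_fingroup all_algebra.
From mathcomp Require Import boolp zify ring.
Set Implicit Arguments.
Unset Strict Implicit.
Unset Printing Implicit Defensive.

Import GRing.Theory Num.Theory.
Local Open Scope ring_scope.

(** * Values of hook polytabloids *)

Section Cochains.
Variable l : nat.
Implicit Types (b w : seq nat) (F : seq nat -> int).

Definition ordseq (m : nat) (f : 'I_m -> nat) : seq nat :=
  [seq f i | i <- enum 'I_m].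

Lemma size_ordseq m (f : 'I_m -> nat) : size (ordseq f) = m.
Proof. by rewrite size_map size_enum_ord. Qed.

Lemma nth_ordseq m (f : 'I_m -> nat) (i : 'I_m) : nth 0%N (ordseq f) i = f i.
Proof. by rewrite (nth_map i) ?size_enum_ord // nth_ord_enum. Qed.

Lemma eq_ordseq m (f g : 'I_m -> nat) : f =1 g -> ordseq f = ordseq g.
Proof. by move=> fg; apply: eq_map. Qed.

Lemma ordseq_nth m w : size w = m -> ordseq (fun i : 'I_m => nth 0%N w i) = w.
Proof.
move=> sw; apply: (@eq_from_nth _ 0%N); rewrite size_ordseq // => i im.
exact: (nth_ordseq _ (Ordinal im)).
Qed.

Lemma ordseq_cons m (f : 'I_m.+1 -> nat) :
  ordseq f = f ord0 :: ordseq (fun i => f (lift ord0 i)).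
Proof. by rewrite /ordseq enum_ordSl /= -map_comp. Qed.

(** Indexing through [lift i] matches both [lift_perm] and the column deletion in cofactors. *)
Definition omit b (i : 'I_l.+1) : seq nat :=
  ordseq (fun r : 'I_l => nth 0%N b (lift i r)).

Lemma omit0 b : size b = l.+1 -> omit b ord0 = behead b.
Proof.
case: b => //= x b [sb]; rewrite -[RHS](ordseq_nth sb).
exact: eq_ordseq.
Qed.

(** Row 0 is constant because the letter moved to the first row of the tabloid is unconstrained; row
    [r + 1] asks for the letter [w_r]. The Leibniz sum of the determinant is thus a signed sum over
    the column stabilizer. *)
Definition polytab_mx b w : 'M[int]_l.+1 :=
  \matrix_(i, j) if unlift ord0 i is Some r
                 then (nth 0%N w r == nth 0%N b j)%:R else 1.

Definition polytab_val b w : int := \det (polytab_mx b w).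

(** Stated on functions, so that permuting the places of a tuple is composition. *)
Definition alternating F : Prop := forall (t : 'S_l) (f : 'I_l -> nat),
  F (ordseq (f \o t)) = (-1) ^+ t * F (ordseq f).

(** Summing over the first argument suffices in the presence of alternation. For [l = 0] there is no
    argument and the condition is empty. *)
Definition sumfree (n : nat) F : Prop := forall w,
  (size w).+1 = l -> \sum_(1 <= s < n.+1) F (s :: w) = 0.

(** Permuting [w] permutes the rows below row 0, and adjoining a fixed point to a permutation keeps
    its sign. *)
Lemma polytab_val_alternating b : alternating (polytab_val b).
Proof.
move=> t f; rewrite /polytab_val.
suff -> : polytab_mx b (ordseq (f \o t)) =
          row_perm (lift_perm ord0 ord0 t) (polytab_mx b (ordseq f)).
  by rewrite row_permE det_mulmx det_perm odd_lift_perm.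
apply/matrixP => i j; rewrite !mxE.
case: (unliftP ord0 i) => [r ->|->]; last by rewrite lift_perm_id unlift_none.
by rewrite lift_perm_lift liftK !nth_ordseq.
Qed.

Lemma polytab_val_notin b w (r : 'I_l) : size b = l.+1 ->
  nth 0%N w r \notin b -> polytab_val b w = 0.
Proof.
move=> sb wr; rewrite /polytab_val (expand_det_row _ (lift ord0 r)).
rewrite big1 // => j _; rewrite mxE liftK.
case: eqP wr => [->|]; last by rewrite mul0r.
by rewrite mem_nth // sb.
Qed.

(** By linearity the sum over [s] acts on the single row of [s], turning it into a second row of
    ones. *)
Lemma polytab_val_sumfree n b : size b = l.+1 ->
    all (fun i => 0 < i <= n)%N b ->
  sumfree n (polytab_val b).
Proof.
move=> sb /allP rb w sw; have l_gt0 : (0 < l)%N by rewrite -sw.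
pose i1 : 'I_l.+1 := lift ord0 (Ordinal l_gt0).
(* [B] carries the summed row [i1]. That row is overwritten, so the 0 in [0 :: w] is a placeholder;
   cofactors along [i1] do not see it. *)
pose B := \matrix_(i, j) if i == i1 then 1 else polytab_mx b (0%N :: w) i j.
have cofE s j : cofactor (polytab_mx b (s :: w)) i1 j = cofactor B i1 j.
  rewrite /cofactor; congr (_ * \det _); apply/matrixP => i k.
  rewrite !mxE eq_sym (negPf (neq_lift _ _)).
  case: unliftP => // r /= Er.
  case: r Er => -[|r] //= rl Er; have := neq_lift i1 i.
  by rewrite Er /i1 (_ : Ordinal _ = Ordinal rl) ?eqxx //; apply: val_inj.
have detB : \det B = 0.
  apply: (@determinant_alternate _ _ _ ord0 i1) => // j.
  by rewrite !mxE unlift_none eqxx /=.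
rewrite -[RHS]detB (expand_det_row B i1).
under eq_bigr do rewrite /polytab_val (expand_det_row _ i1).
rewrite exchange_big /=; apply: eq_bigr => j _.
under eq_bigr do rewrite cofE.
rewrite -mulr_suml; congr (_ * _); rewrite [RHS]mxE eqxx.
under eq_bigr do rewrite mxE liftK /=.
(* The letters of [b] lie in [1, n], so each column is hit by exactly one [s]. *)
have bj : nth 0%N b j \in index_iota 1 n.+1.
  by rewrite mem_index_iota ltnS rb // mem_nth // sb.
rewrite (bigD1_seq _ bj (iota_uniq _ _)) /= eqxx big1 ?addr0 // => s.
by move/negPf ->.
Qed.

(** Column [i] is zero outside row 0, and the complementary minor is the identity matrix. *)
Lemma polytab_val_omit b (i : 'I_l.+1) : size b = l.+1 -> uniq b ->
  polytab_val b (omit b i) = (-1) ^+ i.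
Proof.
move=> sb ub; have nthI (j k : 'I_l.+1) : (nth 0%N b j == nth 0%N b k)
  = (j == k).
  by rewrite nth_uniq ?sb.
rewrite /polytab_val (expand_det_col _ i) (bigD1 ord0) //= big1 => [|j j0].
  rewrite mxE unlift_none mul1r addr0 /cofactor add0n.
  set A := row' _ _; suff -> : A = 1%:M by rewrite det1 mulr1.
  apply/matrixP => r k; rewrite !mxE liftK nth_ordseq nthI.
  by rewrite (inj_eq lift_inj).
case: (unliftP ord0 j) j0 => [r -> _|->]; last by rewrite eqxx.
by rewrite mxE liftK nth_ordseq nthI eq_sym (negPf (neq_lift _ _)) /= mul0r.
Qed.

(** * Vanishing of alternating functions *)

Section Alternating.
Variable F : seq nat -> int.
Hypothesis altF : alternating F.

Lemma alternating_perm w w' : size w' = l -> perm_eq w w' ->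
  F w' = 0 -> F w = 0.
Proof.
move=> sw' ww' F0.
have sz' : size w' == l by rewrite sw'.
have /tuple_permP[t ->] : perm_eq w (Tuple sz') by [].
have -> : [tuple tnth (Tuple sz') (t i) | i < l] =
          ordseq ((fun i : 'I_l => nth 0%N w' i) \o t) :> seq nat.
  by rewrite /= /ordseq; apply: eq_map => i; rewrite (tnth_nth 0%N).
by rewrite altF ordseq_nth // F0 mulr0.
Qed.

Lemma alternating_nuniq w : size w = l -> ~~ uniq w -> F w = 0.
Proof.
move=> sw /(uniqPn 0%N)[i [j [ij jw Ew]]]; rewrite sw in jw.
pose i' := Ordinal (ltn_trans ij jw); pose j' := Ordinal jw.
have := altF (tperm i' j') (fun k : 'I_l => nth 0%N w k).
rewrite odd_tperm -val_eqE /= (ltn_eqF ij) ordseq_nth //= expr1 mulN1r.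
suff -> : ordseq ((fun k : 'I_l => nth 0%N w k) \o tperm i' j') = w by lia.
rewrite -[RHS](ordseq_nth sw); apply: eq_ordseq => k /=.
by case: tpermP => // ->.
Qed.

(** A tuple avoiding [m] has a repetition or is sorted up to sign. If [m] occurs, it is moved to the
    front; the vanishing sum over the first argument then expresses the value through tuples
    avoiding [m]. *)
Lemma alternating_eq0 n m : sumfree n F -> (0 < m <= n)%N ->
  (forall w, size w = l -> sorted ltn w ->
     all (fun i => 0 < i <= n)%N w -> m \notin w -> F w = 0) ->
  forall w, size w = l -> all (fun i => 0 < i <= n)%N w -> F w = 0.
Proof.
move=> sumF mn F0.
have F0' w : size w = l -> all (fun i => 0 < i <= n)%N w -> m \notin w ->
    F w = 0.
  move=> sw aw mw; have [uw|/alternating_nuniq->//] := boolP (uniq w).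
  have pw : perm_eq w (sort leq w) by rewrite perm_sym perm_sort.
  apply: (@alternating_perm _ (sort leq w)); rewrite ?size_sort //.
  apply: F0; rewrite ?size_sort ?mem_sort //.
    by rewrite ltn_sorted_uniq_leq sort_uniq uw sort_sorted //;
      apply: leq_total.
  by rewrite -(perm_all _ pw).
move=> w sw aw; have [mw|] := boolP (m \in w); last exact: F0'.
have [uw|/alternating_nuniq->//] := boolP (uniq w).
have pw := perm_to_rem mw; have sz : size (m :: rem m w) = l.
  by rewrite -(perm_size pw).
apply: (@alternating_perm _ (m :: rem m w)) => //.
have /andP[_ aw'] : all (fun i => 0 < i <= n)%N (m :: rem m w).
  by rewrite -(perm_all _ pw).
have := sumF (rem m w) sz.
rewrite (bigD1_seq m) ?iota_uniq ?mem_index_iota ?ltnS //= big_seq_cond big1.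
  by rewrite addr0.
move=> s; rewrite mem_index_iota ltnS => /andP[sn sm].
apply: F0'; rewrite /= ?sn // inE negb_or eq_sym sm.
by rewrite mem_rem_uniqF.
Qed.

End Alternating.

(** When [F] gives the values of a Specht element, this is its form with the polytabloid of first
    column [b]: the column is permuted, and the entries below the corner are fed to [F]. *)
Definition col_sum F b : int :=
  \sum_(s : 'S_l.+1) (-1) ^+ s *
     F (ordseq (fun r : 'I_l => nth 0%N b (s (lift ord0 r)))).

(** A permutation of the column is the image [i] of the corner together with a permutation [t] of
    the remaining places. Alternation cancels the sign of [t], which leaves l! equal terms for each
    [i]. *)
Lemma col_sum_omit F b : alternating F ->
  col_sum F b = (l`!)%:R * \sum_(i < l.+1) (-1) ^+ i * F (omit b i).
Proof.
move=> altF; pose h (p : 'I_l.+1 * 'S_l) := lift_perm ord0 p.1 p.2.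
have hI : injective h.
  move=> [i s] [j t] E.
  have Eij : i = j by have := congr1 (fun u : 'S_l.+1 => u ord0) E;
      rewrite !lift_perm_id.
  congr pair => //; apply/permP => k; apply: (@lift_inj _ i).
  rewrite -(lift_perm_lift ord0) [in RHS]Eij -(lift_perm_lift ord0).
  by have := congr1 (fun u : 'S_l.+1 => u (lift ord0 k)) E.
have hB : bijective h.
  apply: inj_card_bij => //.
  by rewrite card_prod card_ord !card_Sn factS.
rewrite /col_sum (reindex h) /=; last exact: onW_bij.
rewrite mulr_sumr -(pair_bigA _ (fun i t => (-1) ^+ h (i, t) *
  F (ordseq (fun r : 'I_l => nth 0%N b (h (i, t) (lift ord0 r)))))) /=.
apply: eq_bigr => i _.
rewrite mulr_natl -card_Sn -[RHS]sumr_const; apply: eq_bigr => t _.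
rewrite /h /= odd_lift_perm /=.
rewrite (@eq_ordseq _ _ ((fun r => nth 0%N b (lift i r)) \o t)) ?altF;
  last first.
  by move=> r /=; rewrite lift_perm_lift.
by rewrite signr_addb signr_odd mulrA -[_ * (-1) ^+ t]mulrA -signr_addb addbb
  mulr1.
Qed.

(** Composing with the transposition of two equal entries negates the sum. *)
Lemma col_sum_nuniq F b : size b = l.+1 -> ~~ uniq b -> col_sum F b = 0.
Proof.
move=> sb /(uniqPn 0%N)[i [j [ij jb Eb]]]; rewrite sb in jb.
pose i' := Ordinal (ltn_trans ij jb); pose j' := Ordinal jb.
suff : col_sum F b = - col_sum F b by lia.
rewrite {1}/col_sum (reindex_inj (mulIg (tperm i' j'))) /= -sumrN.
apply: eq_bigr => s _; rewrite odd_permM odd_tperm -val_eqE /= (ltn_eqF ij) /=.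
rewrite signr_addb mulrN1 mulNr; congr (- (_ * F _)).
by apply: eq_ordseq => r; rewrite permM; case: tpermP => // ->.
Qed.

(** Deleting [s] itself leaves [F w], once for each of the [n] letters; every other deletion keeps
    [s] in front and sums to zero. *)
Lemma sum_col_sum F n w : alternating F -> sumfree n F -> size w = l ->
  \sum_(1 <= s < n.+1) col_sum F (s :: w) = (n * l`!)%:R * F w.
Proof.
move=> altF sumF sw.
under eq_bigr do rewrite col_sum_omit // big_ord_recl.
rewrite -mulr_sumr big_split /= exchange_big /= [X in _ + X]big1 ?addr0 =>
  [|i _].
  under eq_bigr do rewrite omit0 /= ?sw // expr0 mul1r.
  by rewrite sumr_const_nat subn1 -[F w *+ _]mulr_natl natrM mulrA; ring.
rewrite -mulr_sumr; case: (posnP l) => [l0|l0]; first by have := ltn_ord i; lia.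
(* [v i] is [w] without its entry of index [i], independently of [s]. *)
pose v i := [seq nth 0%N w (bump i r) | r <- iota 0 l.-1].
suff E s : omit (s :: w) (lift ord0 i) = s :: v i.
  under eq_bigr do rewrite E.
  by rewrite sumF ?mulr0 // size_map size_iota prednK.
apply: (@eq_from_nth _ 0%N) => [|r]; rewrite size_ordseq /=.
  by rewrite size_map size_iota prednK.
move=> rl; rewrite (nth_ordseq _ (Ordinal rl)).
case: r rl => [|r] rl //=.
have rl1 : (r < l.-1)%N by rewrite -ltnS prednK.
rewrite (nth_map 0%N) ?nth_iota ?size_iota // add0n.
by rewrite /bump !add1n ltnS addnS.
Qed.

End Cochains.

(** Either [w] has a letter outside [b], which gives a zero row, or avoiding [b_i] forces it to
    consist of the other letters of [b], in their only increasing order. *)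
Lemma polytab_val_sorted l b (i : 'I_l.+1) w : size b = l.+1 -> uniq b ->
  size w = l -> sorted ltn w -> sorted ltn (omit b i) -> nth 0%N b i \notin w ->
  polytab_val l b w = (-1) ^+ i * (omit b i == w)%:R.
Proof.
move=> sb ub sw ow ob biw.
case: (eqVneq (omit b i) w) => [<-|nw];
  first by rewrite polytab_val_omit ?mulr1.
rewrite mulr0.
have uw : uniq w by move: ow; rewrite ltn_sorted_uniq_leq => /andP[].
have [/allP sub|/allPn[x xw xb]] := boolP (all (mem (omit b i)) w).
  case/eqP: nw; apply: (irr_sorted_eq ltn_trans ltnn) => // x.
  by have [|_ /(_ x)] := uniq_min_size uw sub; rewrite ?size_ordseq ?sw.
have xl : (index x w < l)%N by rewrite -sw index_mem.
apply: (@polytab_val_notin l _ _ (Ordinal xl)); rewrite //= nth_index //.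
apply: contra xb => xb; have kl : (index x b < l.+1)%N by rewrite -sb index_mem.
case: (unliftP i (Ordinal kl)) => [r /(congr1 val) /= rE|/(congr1 val) /= iE].
  apply/mapP; exists r; rewrite ?mem_enum //= -rE.
  by rewrite nth_index.
by rewrite -iE nth_index ?xw // in biw.
Qed.

Lemma polytab_val_cons l m c w : size c = l -> size w = l ->
  sorted ltn c -> sorted ltn w -> m \notin c -> m \notin w ->
  polytab_val l (m :: c) w = (c == w)%:R.
Proof.
move=> sc sw oc ow mc mw; have omE : omit (m :: c) (@ord0 l)
  = c by rewrite omit0 /= ?sc.
rewrite (@polytab_val_sorted _ _ ord0) ?omE ?mul1r //= ?sc // mc.
by move: oc; rewrite ltn_sorted_uniq_leq => /andP[].
Qed.

(** Serves the columns of the second block of [x], which end in [n]. *)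
Lemma polytab_val_rcons l m c w : size c = l -> size w = l ->
  sorted ltn c -> sorted ltn w -> m \notin c -> m \notin w ->
  polytab_val l (rcons c m) w = (-1) ^+ l * (c == w)%:R.
Proof.
move=> sc sw oc ow mc mw; have omE : omit (rcons c m) (@ord_max l) = c.
  rewrite -[RHS](ordseq_nth sc); apply: eq_ordseq => r.
  by rewrite lift_max nth_rcons sc ltn_ord.
rewrite (@polytab_val_sorted _ _ ord_max) ?omE ?size_rcons ?sc //=.
  by rewrite rcons_uniq mc; move: oc; rewrite ltn_sorted_uniq_leq => /andP[].
by rewrite nth_rcons sc ltnn eqxx.
Qed.

(** * Integral bases, Gram matrices and cokernels *)

(** First isomorphism theorem: the map induced through canonical representatives is inverted by
    projecting a chosen preimage. *)
Lemma first_iso (R W : zmodType) (I : zmodClosed R) (h : R -> W) :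
  zmod_morphism h -> (forall w, exists x, h x = w) ->
  (forall x, (h x == 0) = (x \in I)) -> zmod_iso {ideal_quot I} W.
Proof.
move=> hB /boolp.choice[r hr] kerh.
pose Q : zmodType := {ideal_quot I}.
have hpi x y : \pi_{ideal_quot I}%qT x = \pi_{ideal_quot I}%qT y -> h x = h y.
  move=> /eqP; rewrite -Quotient.idealrBE -kerh hB subr_eq0.
  by move=> /eqP.
have hrepr x : h (generic_quotient.repr (\pi_{ideal_quot I}%qT x))
    = h x by apply: hpi; rewrite reprK.
pose g : Q -> W := fun a => h (generic_quotient.repr (a : {ideal_quot I})).
have gB : zmod_morphism g.
  move=> a b; rewrite /g -hB; apply: hpi; rewrite reprK raddfB /=.
  by congr (_ - _); rewrite reprK.
pose gA : {additive Q -> W} := HB.pack g (GRing.isZmodMorphism.Build Q W g gB).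
exists gA.
exists (fun w => \pi_{ideal_quot I}%qT (r w)) => [a|w] /=;
  last by rewrite /g hrepr.
rewrite -[RHS](reprK a); apply/eqP.
by rewrite -Quotient.idealrBE -kerh hB hr subrr.
Qed.

Lemma zmod_morphism_bigsum (V W : zmodType) (f : V -> W) (I : Type) (r : seq I)
    (P : pred I) (F : I -> V) : zmod_morphism f ->
  f (\sum_(i <- r | P i) F i) = \sum_(i <- r | P i) f (F i).
Proof.
move=> fB; pose g : {additive V -> W} :=
  HB.pack f (GRing.isZmodMorphism.Build V W f fB).
by rewrite -[f]/(g : V -> W) raddf_sum.
Qed.

Lemma zmod_morphism_sum (V W : zmodType) (f : V -> W) (m : nat) (v : 'I_m -> V)
    (c : 'I_m -> int) : zmod_morphism f ->
  f (\sum_i v i *~ c i) = \sum_i f (v i) *~ c i.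
Proof.
move=> fB; pose g : {additive V -> W} :=
  HB.pack f (GRing.isZmodMorphism.Build V W f fB).
rewrite -[f]/(g : V -> W) raddf_sum.
by apply: eq_bigr => i _; rewrite raddfMz.
Qed.

Lemma zmod_morphism_sum2 (V W : zmodType) (f : V -> W) (k m : nat)
    (u : 'I_k -> V) (v : 'I_m -> V) (c : 'I_k -> int) (d : 'I_m -> int) :
  zmod_morphism f ->
  f (\sum_i u i *~ c i + \sum_i v i *~ d i) =
  \sum_i f (u i) *~ c i + \sum_i f (v i) *~ d i.
Proof.
move=> fB; pose g : {additive V -> W} :=
  HB.pack f (GRing.isZmodMorphism.Build V W f fB).
by rewrite -[f]/(g : V -> W) raddfD; congr (_ + _); apply: zmod_morphism_sum.
Qed.

Definition Zquot_pi (D : nat) (a : int) : Zquot D :=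
  \pi_{ideal_quot (GRing.ZmodClosed.clone int (dvdz D) _)}%qT a.

Lemma Zquot_pi_zmod_morphism D : zmod_morphism (Zquot_pi D).
Proof. exact: raddfB. Qed.

Lemma Zquot_pi_surj D (a : Zquot D) : exists r, Zquot_pi D r = a.
Proof. by exists (generic_quotient.repr a); exact: reprK. Qed.

Lemma Zquot_pi_eq0 D r : (Zquot_pi D r == 0) = (D %| r)%Z.
Proof.
have <- : Zquot_pi D 0 = 0.
  by have := Zquot_pi_zmod_morphism D 0 0; rewrite !subrr.
by rewrite /Zquot_pi -Quotient.idealrBE subr0.
Qed.

(** * Integral bases detected by dual functionals *)

Section Functionals.
Variable V : zmodType.
Implicit Types (e x y : seq V) (p : nat -> V -> int).

(** The [p i] read off the coefficients, which gives uniqueness; the defect of the resulting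
    expansion is killed by all [p i], which gives existence. *)
Lemma Zbasis_dual e p : (forall i, zmod_morphism (p i)) ->
  (forall i j, (i < size e)%N -> (j < size e)%N -> p i e`_j = (i == j)%:R) ->
  (forall v, (forall i, (i < size e)%N -> p i v = 0) -> v = 0) -> Zbasis e.
Proof.
move=> pB pe p0 v.
have pE (c : {ffun 'I_(size e) -> int}) (i : 'I_(size e)) :
    p i (\sum_(j < size e) e`_j *~ c j) = c i.
  rewrite zmod_morphism_sum // (bigD1 i) //= pe // eqxx [X in _ + X]big1 ?addr0.
    by rewrite mulr1n intz.
  by move=> j; rewrite -val_eqE => /negPf /= ji;
    rewrite pe // eq_sym ji mulr0n mul0rz.
exists [ffun i => p (val i) v]; split=> [|c vE]; last first.
  by apply/ffunP => i; rewrite ffunE vE pE.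
apply/eqP; rewrite -subr_eq0; apply/eqP/p0 => i ie.
by rewrite pB (pE _ (Ordinal ie)) ffunE subrr.
Qed.

(** The pairing is only block triangular, as [p1] is unrestricted on [e2]. *)
Lemma Zbasis_block_dual e1 e2 p1 p2 :
  (forall i, zmod_morphism (p1 i)) -> (forall i, zmod_morphism (p2 i)) ->
  (forall i j, (i < size e1)%N -> (j < size e1)%N ->
    p1 i e1`_j = (i == j)%:R) ->
  (forall i j, (i < size e2)%N -> (j < size e1)%N -> p2 i e1`_j = 0) ->
  (forall i j, (i < size e2)%N -> (j < size e2)%N ->
    p2 i e2`_j = (i == j)%:R) ->
  (forall v, (forall i, (i < size e1)%N -> p1 i v = 0) ->
             (forall i, (i < size e2)%N -> p2 i v = 0) -> v = 0) ->
  Zbasis (e1 ++ e2).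
Proof.
move=> p1B p2B p11 p21 p22 p0.
(* Subtracting combinations of the [p2 j] makes [p1 i] vanish on [e2] and leaves its values on [e1]
   unchanged, since [p2] is zero there. *)
pose p i v := if (i < size e1)%N
  then p1 i v - \sum_(j < size e2) p2 j v * p1 i e2`_j else p2 (i - size e1)%N
    v.
apply: (@Zbasis_dual _ p) => [i u v|i j|v].
- rewrite /p; case: ifP => _; last exact: p2B.
  rewrite p1B !opprD !opprK addrACA; congr (_ + _).
  rewrite addrC -sumrB -sumrN; apply: eq_bigr => j _.
  by rewrite p2B mulrBl opprB.
- rewrite size_cat /p nth_cat => il jl.
  case: ltnP => ie; case: ltnP => je.
  + by rewrite p11 // big1 ?subr0 // => k _; rewrite p21 ?mul0r.
  + have j2 : (j - size e1 < size e2)%N by rewrite ltn_subLR.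
    rewrite (bigD1 (Ordinal j2)) //= p22 // eqxx mul1r big1 ?addr0 ?subrr.
      by rewrite (ltn_eqF (leq_trans ie je)).
    by move=> k; rewrite -val_eqE => /negPf /= kj;
      rewrite p22 // kj mulr0n mul0r.
  + rewrite p21 // ?ltn_subLR // gtn_eqF //; exact: leq_trans je ie.
  + by rewrite p22 ?ltn_subLR // -(eqn_add2l (size e1)) !subnKC.
move=> pv; have p2v i : (i < size e2)%N -> p2 i v = 0.
  move=> ie; have := pv (size e1 + i)%N.
  by rewrite size_cat ltn_add2l ie /p ltnNge leq_addr /= addKn => ->.
apply: p0 => // i ie; have := pv i; rewrite size_cat /p ie.
rewrite (leq_trans ie (leq_addr _ _)) => /(_ isT).
by rewrite big1 ?subr0 // => j _; rewrite p2v ?mul0r.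
Qed.

Lemma Zbasis_span e m v : Zbasis e -> size e = m ->
  exists c : 'I_m -> int, v = \sum_(i < m) e`_i *~ c i.
Proof. by move=> eb <-; have [c [-> _]] := eb v; exists c. Qed.

Lemma Zbasis_free e m (c d : 'I_m -> int) : Zbasis e -> size e = m ->
  \sum_(i < m) e`_i *~ c i = \sum_(i < m) e`_i *~ d i -> c =1 d.
Proof.
move=> eb em; case: m / em c d => c d E i.
have [a [_ aU]] := eb (\sum_(i < _) e`_i *~ c i).
have {aU}aU (b : 'I_(size e) -> int) :
      \sum_(i < size e) e`_i *~ c i = \sum_(i < size e) e`_i *~ b i ->
        a i = b i.
  move=> Eb; rewrite (aU [ffun k => b k]) ?ffunE //.
  by rewrite Eb; apply: eq_bigr => k _; rewrite ffunE.
by rewrite -(aU c) // -(aU d).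
Qed.

(** Substituting one expansion into the other writes each [x_i] in terms of [x], and freeness
    compares coefficients. *)
Lemma Zbasis_change x y m (P Q : 'M[int]_m) : Zbasis x -> size x = m ->
  (forall i : 'I_m, x`_i = \sum_(j < m) y`_j *~ P i j) ->
  (forall i : 'I_m, y`_i = \sum_(j < m) x`_j *~ Q i j) -> P *m Q = 1%:M.
Proof.
move=> xb xm xP yQ; apply/matrixP => i k.
have := @Zbasis_free x m ((P *m Q) i) ((1%:M : 'M[int]_m) i) xb xm; apply.
rewrite [RHS](bigD1 i) //= mxE eqxx mulr1z [X in _ + X]big1 ?addr0; last first.
  by move=> j /negPf ji; rewrite mxE eq_sym ji mulr0z.
rewrite [RHS]xP; under [RHS]eq_bigr do rewrite yQ mulrz_suml.
rewrite exchange_big /=; apply: eq_bigr => j _.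
rewrite mxE mulrz_sumr; apply: eq_bigr => a _.
by rewrite -mulrzA mulrC.
Qed.

Lemma Zbasis_cat_span e1 e2 k1 k2 v : Zbasis (e1 ++ e2) ->
  size e1 = k1 -> size e2 = k2 -> exists (c1 : 'I_k1 -> int) (c2 : 'I_k2 ->
    int),
  v = \sum_(i < k1) e1`_i *~ c1 i + \sum_(i < k2) e2`_i *~ c2 i.
Proof.
move=> eb e1k e2k; have sz : size (e1 ++ e2)
  = (k1 + k2)%N by rewrite size_cat e1k e2k.
have [c ->] := Zbasis_span v eb sz.
exists (c \o @lshift k1 k2), (c \o @rshift k1 k2); rewrite big_split_ord /=.
congr (_ + _); apply: eq_bigr => i _; rewrite nth_cat e1k /= ?ltn_ord //.
by rewrite ltnNge leq_addr /= addKn.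
Qed.

Section Form.
Variable form : V -> V -> int.
Hypothesis formBl : forall v, zmod_morphism (form^~ v).

(** The determinant condition is automatic for two bases: the matrix of the [(x_i, y_j)] is the Gram
    matrix of [y] times a transition matrix, which is invertible over the integers and so has
    determinant 1 or -1. *)
Lemma trigonalizesI x y : Zbasis x -> Zbasis y -> size x = size y ->
  (forall i, (i < size y)%N -> form x`_i y`_i != 0) ->
  (forall i j, (j < i < size y)%N -> form x`_i y`_j = 0) ->
  (forall i j, (i < j < size y)%N -> (form x`_i y`_i %| form x`_i y`_j)%Z) ->
  (forall i, (i.+1 < size y)%N -> (form x`_i y`_i %| form x`_i.+1 y`_i.+1)%Z) ->
  trigonalizes form x y.
Proof.
move=> xb yb xy Hnz H0 Hdvd Hchain; exists y; split=> //; split=> //=.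
have spanP (i : 'I_(size y)) := @Zbasis_span y (size y) x`_i yb erefl.
have spanQ (i : 'I_(size y)) := @Zbasis_span x (size y) y`_i xb xy.
have [P xP] := boolp.choice spanP; have [Q yQ] := boolp.choice spanQ.
pose PM : 'M[int]_(size y) := \matrix_(i, j) P i j.
pose QM : 'M[int]_(size y) := \matrix_(i, j) Q i j.
have PQ : PM *m QM = 1%:M.
  apply: (@Zbasis_change x y) => // i.
    by rewrite xP; apply: eq_bigr => j _; rewrite mxE.
  by rewrite yQ; apply: eq_bigr => j _; rewrite mxE.
have [+ _] := mulmx1_unit PQ; rewrite unitmxE => detP.
pose X : 'M[int]_(size y) := \matrix_(i, j) form x`_i y`_j.
have XE : X = PM *m gram form y.
  apply/matrixP => i j; rewrite !mxE xP (zmod_morphism_sum _ _ (formBl _)).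
  by apply: eq_bigr => k _; rewrite !mxE -mulrzr intz mulrC.
have <- : \det X = \prod_(i < size y) form x`_i y`_i.
  (* The matrix is upper triangular, whereas [det_trig] asks for lower triangular. *)
  rewrite -det_tr det_trig; first by apply: eq_bigr => i _; rewrite !mxE.
  by apply/is_trig_mxP => i j ij; rewrite !mxE H0 // ij /=.
rewrite XE det_mulmx.
have : (\det PM == 1) || (\det PM == -1) := detP.
by case/orP => /eqP ->; [left; rewrite mul1r | right; rewrite mulN1r].
Qed.
End Form.

End Functionals.

(** Diagonal case. The [q] are dual to the [z], and [f] sends each [x] to [D1] or [D2] times the
    corresponding [q]. Evaluation at the [z] followed by reduction is therefore onto, with kernel
    the image of [f]. *)
Lemma dvdz_coker_iso (V : zmodType) (f : {additive V ->
    Zdual V}) (k1 k2 D1 D2 : nat)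
    (x1 z1 : 'I_k1 -> V) (x2 z2 : 'I_k2 -> V)
    (q1 : 'I_k1 -> Zdual V) (q2 : 'I_k2 -> Zdual V) :
  (forall i j, val (q1 i) (z1 j) = (i == j)%:R) ->
  (forall i j, val (q1 i) (z2 j) = 0) ->
  (forall i j, val (q2 i) (z1 j) = 0) ->
  (forall i j, val (q2 i) (z2 j) = (i == j)%:R) ->
  (forall u : Zdual V, (forall i, val u (z1 i) = 0) ->
     (forall i, val u (z2 i) = 0) -> u = 0) ->
  (forall i j, val (f (x1 i)) (z1 j) = (i == j)%:R * D1%:Z) ->
  (forall i j, val (f (x1 i)) (z2 j) = 0) ->
  (forall i j, val (f (x2 i)) (z1 j) = 0) ->
  (forall i j, val (f (x2 i)) (z2 j) = (i == j)%:R * D2%:Z) ->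
  (forall v, exists c1 c2,
     v = \sum_i x1 i *~ c1 i + \sum_i x2 i *~ c2 i) ->
  zmod_iso (coker f) ({ffun 'I_k1 -> Zquot D1} * {ffun 'I_k2 -> Zquot D2})%type.
Proof.
move=> q11 q12 q21 q22 sep f11 f12 f21 f22 span.
pose ev (v : V) (u : Zdual V) : int := val u v.
have evB v : zmod_morphism (ev v) by [].
have evfB v : zmod_morphism (fun w => ev v (f w)).
  by move=> a b; rewrite raddfB.
have delta_sum k (g : 'I_k -> 'I_k -> int) D (c : 'I_k -> int) (i : 'I_k) :
    (forall j, g j i = (j == i)%:R * D) -> \sum_j g j i *~ c j = D * c i.
  move=> gE; rewrite (bigD1 i) //= gE eqxx mul1r [X in _ + X]big1 ?addr0.
    by rewrite -mulrzr intz.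
  by move=> j /negPf ji; rewrite gE ji mul0r mul0rz.
have zero_sum k (g : 'I_k -> int) (c : 'I_k -> int) :
    (forall j, g j = 0) -> \sum_j g j *~ c j = 0.
  by move=> g0; rewrite big1 // => j _; rewrite g0 mul0rz.
have evq1 r s i : ev (z1 i) (\sum_j q1 j *~ r j + \sum_j q2 j *~ s j) = r i.
  rewrite zmod_morphism_sum2 // (delta_sum _ (fun j i => ev (z1 i) (q1 j)) 1).
    by rewrite mul1r zero_sum ?addr0 // => j; apply: q21.
  by move=> j; rewrite mulr1; apply: q11.
have evq2 r s i : ev (z2 i) (\sum_j q1 j *~ r j + \sum_j q2 j *~ s j) = s i.
  rewrite zmod_morphism_sum2 // [X in X + _]zero_sum; last by move=> j;
    apply: q12.
  rewrite (delta_sum _ (fun j i => ev (z2 i) (q2 j)) 1) ?mul1r ?add0r //.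
  by move=> j; rewrite mulr1; apply: q22.
have evf1 r s i : 
    ev (z1 i) (f (\sum_j x1 j *~ r j + \sum_j x2 j *~ s j)) = D1%:Z * r i.
  rewrite (zmod_morphism_sum2 _ _ _ _ (evfB _)).
  rewrite (delta_sum _ (fun j i => ev (z1 i) (f (x1 j))) D1%:Z);
    last by move=> j; apply: f11.
  by rewrite zero_sum ?addr0 // => j; apply: f21.
have evf2 r s i : 
    ev (z2 i) (f (\sum_j x1 j *~ r j + \sum_j x2 j *~ s j)) = D2%:Z * s i.
  rewrite (zmod_morphism_sum2 _ _ _ _ (evfB _)) [X in X + _]zero_sum;
    last by move=> j; apply: f12.
  rewrite (delta_sum _ (fun j i => ev (z2 i) (f (x2 j))) D2%:Z) ?add0r //.
  by move=> j; apply: f22.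
pose h (u : Zdual V) := ([ffun i => Zquot_pi D1 (ev (z1 i) u)],
                         [ffun i => Zquot_pi D2 (ev (z2 i) u)]).
apply: (@first_iso _ _ _ h) => [u v|[a b]|u].
- by congr pair; apply/ffunP => i; rewrite !ffunE evB Zquot_pi_zmod_morphism.
- have [r ra] := boolp.choice (fun i => Zquot_pi_surj (a i)).
  have [s sb] := boolp.choice (fun i => Zquot_pi_surj (b i)).
  exists (\sum_j q1 j *~ r j + \sum_j q2 j *~ s j).
  by congr pair; apply/ffunP => i; rewrite ffunE ?evq1 ?evq2 ?ra ?sb.
apply/eqP/boolp.asboolP => [[/ffunP u1 /ffunP u2]|[v <-]].
  have /boolp.choice[r rE] i : exists r, ev (z1 i) u = D1%:Z * r.
    have /eqP := u1 i.
    rewrite !ffunE Zquot_pi_eq0 => /dvdzP[c ->]; exists c; exact: mulrC.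
  have /boolp.choice[s sE] i : exists s, ev (z2 i) u = D2%:Z * s.
    have /eqP := u2 i.
    rewrite !ffunE Zquot_pi_eq0 => /dvdzP[c ->]; exists c; exact: mulrC.
  exists (\sum_j x1 j *~ r j + \sum_j x2 j *~ s j).
  apply/eqP; rewrite -subr_eq0; apply/eqP/sep => i.
    by rewrite -[LHS]/(ev _ _) evB evf1 rE subrr.
  by rewrite -[LHS]/(ev _ _) evB evf2 sE subrr.
have [r [s ->]] := span v.
by congr pair; apply/ffunP => i; rewrite !ffunE; apply/eqP;
  rewrite Zquot_pi_eq0 ?evf1 ?evf2 dvdz_mulr ?dvdzz.
Qed.

(** The upper right block is divisible by [D1], so a unitriangular change of the [y2] clears it and
    leads to the diagonal case. *)
Lemma dvdz_coker_iso_block (V : zmodType) (f : {additive V -> Zdual V})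
    (k1 k2 D1 D2 : nat) (x1 y1 : 'I_k1 -> V) (x2 y2 : 'I_k2 -> V)
    (p1 : 'I_k1 -> V -> int) (p2 : 'I_k2 -> V -> int) (A : 'I_k1 -> 'I_k2 ->
      int) :
  (forall i, zmod_morphism (p1 i)) -> (forall i, zmod_morphism (p2 i)) ->
  (forall i j, p1 i (y1 j) = (i == j)%:R) -> (forall i j, p1 i (y2 j) = 0) ->
  (forall i j, p2 i (y1 j) = 0) -> (forall i j, p2 i (y2 j) = (i == j)%:R) ->
  (forall i j, val (f (x1 i)) (y1 j) = (i == j)%:R * D1%:Z) ->
  (forall i j, val (f (x1 i)) (y2 j) = D1%:Z * A i j) ->
  (forall i j, val (f (x2 i)) (y1 j) = 0) ->
  (forall i j, val (f (x2 i)) (y2 j) = (i == j)%:R * D2%:Z) ->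
  (forall v, exists c1 c2, v = \sum_i x1 i *~ c1 i + \sum_i x2 i *~ c2 i) ->
  (forall v, exists c1 c2, v = \sum_i y1 i *~ c1 i + \sum_i y2 i *~ c2 i) ->
  zmod_iso (coker f) ({ffun 'I_k1 -> Zquot D1} * {ffun 'I_k2 -> Zquot D2})%type.
Proof.
move=> p1B p2B p11 p12 p21 p22 f11 f12 f21 f22 spanx spany.
pose z j := y2 j - \sum_i y1 i *~ A i j.
have dualP (g : V -> int) : zmod_morphism g -> exists q : Zdual V, val q = g.
  move=> gB; suff gP : g \in @additive_pred V by exists (Sub g gP);
    rewrite SubK.
  pose gA : {additive V -> int} :=
      HB.pack g (GRing.isZmodMorphism.Build V int g gB).
  by apply/boolp.asboolP => u v; apply: (raddfD gA).
have valB (q : Zdual V) : zmod_morphism (val q).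
  case: q => g /= /boolp.asboolP gD u v.
  by apply/eqP; rewrite eq_sym subr_eq -gD subrK.
have zE (g : V -> int) j : zmod_morphism g ->
    g (z j) = g (y2 j) - \sum_i g (y1 i) * A i j.
  move=> gB; rewrite gB zmod_morphism_sum //; congr (_ - _).
  by apply: eq_bigr => i _; rewrite -mulrzr intz.
have delta k (F : 'I_k -> int) i : \sum_j (i == j)%:R * F j = F i.
  rewrite (bigD1 i) //= eqxx mul1r big1 ?addr0 // => j /negPf ji.
  by rewrite eq_sym ji mul0r.
have deltar k (F : 'I_k -> int) i : \sum_j (j == i)%:R * F j = F i.
  by rewrite -[RHS]delta; apply: eq_bigr => j _; rewrite eq_sym.
(* The dual basis changes contragrediently: adding [A i j] times [p2 j] makes [q1 i] vanish on
   [z j]. *)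
have /boolp.choice[q1 q1E] i : exists q : Zdual V,
    val q = fun v => p1 i v + \sum_j p2 j v * A i j.
  apply: dualP => u v; rewrite p1B opprD addrACA -sumrB; congr (_ + _).
  by apply: eq_bigr => j _; rewrite p2B mulrBl.
have /boolp.choice[q2 q2E] i := dualP (p2 i) (p2B i).
apply: (@dvdz_coker_iso _ f k1 k2 D1 D2 x1 y1 x2 z q1 q2) => //.
- move=> i j; rewrite q1E p11 big1 ?addr0 // => k _; by rewrite p21 mul0r.
- move=> i j; rewrite zE // q1E p12 add0r.
  under eq_bigr do rewrite p22.
  rewrite deltar; under eq_bigr => k _.
    rewrite p11 big1 ?addr0; last by move=> r _; rewrite p21 mul0r.
    over.
  by rewrite delta subrr.
- by move=> i j; rewrite q2E p21.
- move=> i j; rewrite zE // q2E p22 big1 ?subr0 // => k _.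
  by rewrite p21 mul0r.
- move=> u u1 u2; apply: val_inj; apply/boolp.funext => v.
  have [c1 [c2 ->]] := spany v; rewrite (zmod_morphism_sum2 _ _ _ _ (valB u)).
  rewrite big1 ?add0r => [|i _]; last by rewrite u1 mul0rz.
  rewrite big1 // => i _.
  have := u2 i; rewrite zE // big1 ?subr0 => [->|j _]; first by rewrite mul0rz.
  by rewrite u1 mul0r.
- move=> i j; rewrite zE // f12; under eq_bigr do rewrite f11 -mulrA.
  by rewrite delta subrr.
- move=> i j; rewrite zE // f22 big1 ?subr0 // => k _.
  by rewrite f21 mul0r.
Qed.

(** * Tableaux of hook shape *)

(** Turns permutations of places into permutations of letters. A product of transpositions carries
    over factor by factor, sign included. *)
Lemma perm_extension (T S : finType) (b : T -> S) : injective b ->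
  forall s : {perm T}, exists u : {perm S},
    [/\ forall j, u (b j) = b (s j), forall k, k \notin codom b -> u k = k
      & odd_perm u = odd_perm s].
Proof.
move=> bI s; have [ts -> _] := prod_tpermP s.
elim: ts => [|t ts [u [uE uF uO]]].
  exists 1%g; rewrite big_nil !odd_perm1.
  by split=> // [j|k _]; rewrite !perm1.
exists (tperm (b t.1) (b t.2) * u)%g; rewrite big_cons; split=> [j|k kb|].
- by rewrite !permM -uE; congr (u _); rewrite !permE /= !(inj_eq bI);
    do 2?case: ifP.
- rewrite permM tpermD ?uF //; apply: contraNneq kb => <-; exact: codom_f.
- by rewrite !odd_permM !odd_tperm (inj_eq bI) uO.
Qed.

Section Hook.
Variables n l : nat.
Hypothesis ln : (l < n)%N.

Notation sh := (hook n l).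
Notation tableau := (tableau n sh).
Notation tabloid := (tabloid n sh).
Notation specht := (specht n sh).

Lemma size_hook : size sh = l.+1.
Proof. by rewrite /= size_nseq. Qed.

Fact arm_gt0 : (0 < head 0 sh)%N.
Proof. by rewrite /= subn_gt0. Qed.

Fact leg_cell_subproof (j : 'I_l.+1) :
  let c := (cast_ord (esym size_hook) j, Ordinal arm_gt0) in
  (c.2 < nth 0 sh c.1)%N.
Proof.
case: j => -[|j] jl /=; first exact: arm_gt0.
by rewrite ltnS in jl; rewrite nth_nseq jl.
Qed.
Definition leg_cell (j : 'I_l.+1) : cell sh :=
  Sub (cast_ord (esym size_hook) j, Ordinal arm_gt0) (leg_cell_subproof j).

Fact arm_cell_subproof (j : 'I_(n - l)) :
  let c := (cast_ord (esym size_hook) ord0, j)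
           : 'I_(size sh) * 'I_(head 0 sh)%N in
  (c.2 < nth 0 sh c.1)%N.
Proof. exact: ltn_ord. Qed.
Definition arm_cell (j : 'I_(n - l)) : cell sh :=
  Sub (cast_ord (esym size_hook) ord0, j : 'I_(head 0%N sh))
      (arm_cell_subproof j).

(** Leg and arm share the corner, which is counted with the leg here; hence [0 < j] on the arm. *)
Lemma cellP (c : cell sh) :
  (exists2 j, c = leg_cell j & col_of c = 0 :> nat) \/
  (exists2 j : 'I_(n - l), c = arm_cell j & (0 < j)%N).
Proof.
case: c => -[i j] /= ij; case: (posnP j) => [j0|jp]; [left|right].
  exists (cast_ord size_hook i); rewrite ?/col_of //=.
  by apply: val_inj; congr pair; apply: val_inj.
exists j => //; apply: val_inj; congr pair; apply: val_inj => /=.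
case: i ij => -[|i] //= il; rewrite nth_nseq; case: ifP => _;
  last by rewrite ltn0.
by rewrite ltnS leqn0 gtn_eqF.
Qed.

Lemma leg_cell_inj : injective leg_cell.
Proof. by move=> i j /(congr1 (fun c => row_of c : nat)) /= /val_inj. Qed.

Definition leg (a : tableau) (j : 'I_l.+1) : 'I_n := val a (leg_cell j).
Definition first_col (a : tableau) : seq nat := ordseq (fun j => (leg a j).+1).

Lemma tableau_inj (a : tableau) : injective (val a).
Proof. by case: a => a /= /andP[/injectiveP]. Qed.

Lemma tableau_surj (a : tableau) k : exists c, val a c = k.
Proof.
by case: a => a /= /andP[_ /forallP/(_ k)/existsP[c /eqP]]; exists c.
Qed.

Lemma leg_inj a : injective (leg a).
Proof. by move=> i j /tableau_inj /leg_cell_inj. Qed.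

Lemma size_first_col a : size (first_col a) = l.+1.
Proof. exact: size_ordseq. Qed.

Lemma nth_first_col a (j : 'I_l.+1) : nth 0%N (first_col a) j = (leg a j).+1.
Proof. exact: nth_ordseq. Qed.

Lemma first_col_range a : all (fun i => 0 < i <= n)%N (first_col a).
Proof. by apply/allP => _ /mapP[j _ ->]; rewrite ltn_ord. Qed.

Lemma first_col_uniq a : uniq (first_col a).
Proof.
rewrite map_inj_uniq ?enum_uniq // => i j /eqP.
by rewrite eqSS => /eqP/val_inj/leg_inj.
Qed.

Lemma behead_first_col a :
  behead (first_col a) = ordseq (fun r : 'I_l => (leg a (lift ord0 r)).+1).
Proof. by rewrite /first_col ordseq_cons. Qed.

Lemma has_first_colE a b : has_first_col a b = (b == first_col a).
Proof.
apply/andP/eqP => [[/eqP sb /forallP bE]|->].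
  rewrite size_hook in sb.
  apply: (@eq_from_nth _ 0%N); rewrite ?size_first_col // sb => i il.
  have /implyP/(_ isT)/eqP/(onth_nth 0%N) := bE (leg_cell (Ordinal il)).
  by rewrite (nth_first_col a (Ordinal il)).
split; first by rewrite size_first_col /= size_nseq.
apply/forallP => c.
case: (cellP c) => [[j -> _]|[j -> jp]]; last by rewrite /col_of /= gtn_eqF.
apply/implyP => _.
by rewrite /row_of /= onthE (nth_map 0%N) ?size_first_col // nth_first_col.
Qed.

Definition leg_row (r : 'I_l) : 'I_(size sh) :=
    cast_ord (esym size_hook) (lift ord0 r).

Lemma rows_leg (a : tableau) r k : (k \in rows a (leg_row r))
    = (k == leg a (lift ord0 r)).
Proof.
rewrite ffunE; apply/imsetP/eqP => [[c]|->]; last first.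
  by exists (leg_cell (lift ord0 r)); rewrite // inE.
rewrite inE; case: (cellP c) => [[j -> _]|[j -> jp]] /eqP/(congr1 val) //=.
by move=> jr ->; congr (val a (leg_cell _)); apply: val_inj.
Qed.

(** The rows below the first are singletons, and the first row is their complement. *)
Lemma tabloid_ofE (a : tableau) (t : tabloid) :
  (forall r, leg a (lift ord0 r) \in val t (leg_row r)) -> t = tabloid_of a.
Proof.
case: t => t tP /= aa'; apply: val_inj => /=.
have /existsP[a' /eqP tE] := tP; move: aa'; rewrite tE => aa'.
have {}aa' r : leg a (lift ord0 r) = leg a' (lift ord0 r).
  by apply/eqP; rewrite -rows_leg aa'.
have sub (b b' : tableau) i : (forall r, leg b (lift ord0 r)
    = leg b' (lift ord0 r)) ->
    rows b i \subset rows b' i.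
  move=> bb'; have [[r ->]|i0] : (exists r, i = leg_row r) \/ i = 0%N :> nat.
    case: i => -[|i] il; [by right | left].
    have il' : (i < l)%N by rewrite size_hook in il.
    by exists (Ordinal il'); apply: val_inj.
    by apply/subsetP => k; rewrite !rows_leg bb'.
  (* First row: a letter standing below the corner in [b'] would stand in the same leg cell of [b],
     hence not in its first row. *)
  apply/subsetP => k; rewrite !ffunE => /imsetP[c]; rewrite inE => /eqP ci kE.
  have [c' c'E] := tableau_surj b' k; apply/imsetP; exists c' => //.
  rewrite inE -val_eqE /= i0.
  case: (cellP c') c'E => [[j -> _]|[j -> _] _]; last by [].
  rewrite -/(leg b' j); case: (unliftP ord0 j) => [r ->|->] //.
  rewrite -bb' kE => /tableau_inj E.
  by have := congr1 (fun c => row_of c : nat) E; rewrite ci i0.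
by apply/ffunP => i; apply/eqP; rewrite eqEsubset !sub.
Qed.

Lemma tabloidP (t : tabloid) : exists a, t = tabloid_of a.
Proof.
by case: t => t tP; have /existsP[a /eqP E] := tP; exists a; apply: val_inj.
Qed.

(** * Column stabilizers and pairings with polytabloids *)

Lemma tabloid_act_of (a : tableau) s :
  tabloid_act (tabloid_of a) s = tabloid_of (tableau_act a s).
Proof.
apply: val_inj; apply/ffunP => r; rewrite !ffunE -imset_comp.
by apply: eq_imset => c; rewrite /= ffunE.
Qed.

Lemma leg_act (a : tableau) s j : leg (tableau_act a s) j = s (leg a j).
Proof. by rewrite /leg /= ffunE. Qed.

(** All columns but the first are single cells, so their letters are fixed. *)
Lemma col_stabP (a : tableau) (s : 'S_n) :
  (s \in col_stab a) <->
  (forall k, k \notin codom (leg a) -> s k = k) /\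
  (forall j, s (leg a j) \in codom (leg a)).
Proof.
rewrite inE; split=> [/forallP sP|[sF sC]].
  have C0 : [set val a c | c in [pred c | col_of c == Ordinal arm_gt0]]
      = [set k in codom (leg a)].
    apply/setP => k; rewrite inE; apply/imsetP/codomP => [[c]|[j ->]].
      rewrite inE; case: (cellP c) => [[j -> _] _ ->|[j -> jp]];
        first by exists j.
      by rewrite -val_eqE /col_of /= gtn_eqF.
    by exists (leg_cell j); rewrite // inE.
  split=> [k|j]; last first.
    have /eqP E := sP (Ordinal arm_gt0); rewrite C0 in E.
    have : s (leg a j) \in s @: [set k in codom (leg a)].
      by apply: imset_f; rewrite inE codom_f.
    by rewrite E inE.
  have [c <-] := tableau_surj a k.
  case: (cellP c) => [[j -> _]|[j -> jp] _];
    first by rewrite -/(leg a j) codom_f.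
  have /eqP := sP (j : 'I_(head 0%N sh)).
  suff -> : [set val a c | c in [pred c | col_of c == j :> 'I_(head 0%N sh)]] =
            [set val a (arm_cell j)].
    by rewrite imset_set1 => /set1_inj.
  apply/setP => k'; rewrite inE; apply/imsetP/eqP => [[c']|->]; last first.
    by exists (arm_cell j); rewrite // inE.
  rewrite inE -val_eqE; case: (cellP c') => [[i -> i0]|[i -> _] /eqP E ->].
    by rewrite /col_of /= eq_sym gtn_eqF.
  by congr (val a (arm_cell _)); apply: val_inj.
apply/forallP => j; rewrite /= eqEcard (card_imset _ (@perm_inj _ s)) leqnn
  andbT.
apply/subsetP => _ /imsetP[_ /imsetP[c cj ->] ->].
case: (cellP c) cj => [[i -> _]|[i -> ip]] cj.
  rewrite -/(leg a i); have /codomP[i' ->] := sC i.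
  by apply: imset_f; rewrite !inE in cj *.
rewrite sF ?imset_f //; apply/codomP => -[i' /tableau_inj].
move/(congr1 (fun c => col_of c : nat)); rewrite /col_of /= => i0.
by rewrite i0 in ip.
Qed.

(** The column stabilizer is a copy of ['S_l.+1] permuting the places of the leg, with the same
    signs. A general [X] covers both the values of a polytabloid ([X] an indicator) and the form
    ([X] a vector). *)
Lemma polytabloid_pairing (a : tableau) (X : tabloid -> int) (Y : seq nat ->
    int) :
  (forall a', X (tabloid_of a') = Y (behead (first_col a'))) ->
  \sum_t polytabloidM a t * X t = col_sum l Y (first_col a).
Proof.
move=> XY; have /boolp.choice[ext extP] := perm_extension (@leg_inj a).
have extI : injective ext.
  move=> s s' E; apply/permP => j; apply: (@leg_inj a).
  by have [<- _ _] := extP s; have [<- _ _] := extP s'; rewrite E.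
have stabE : col_stab a = [set ext s | s : 'S_l.+1].
  apply/setP => s; apply/idP/imsetP => [/col_stabP[sF sC]|[s' _ ->]];
    last first.
    have [sE sF _] := extP s'; apply/col_stabP; split=> // j.
    by rewrite sE codom_f.
  (* [f] is [s] read on places: [f j] is where the letter [s (leg a j)] stands. *)
  pose f j := iinv (sC j).
  have fE j : leg a (f j) = s (leg a j) by rewrite f_iinv.
  have fI : injective f.
    by move=> i j E; apply: (@leg_inj a); apply: (@perm_inj _ s);
      rewrite -!fE E.
  exists (perm fI) => //; apply/permP => k.
  have [eE eF _] := extP (perm fI).
  have [/codomP[j ->]|kC] := boolP (k \in codom (leg a));
      last by rewrite sF ?eF.
  by rewrite eE permE fE.
rewrite /polytabloidM stabE.
transitivity (\sum_(s : 'S_l.+1) (-1) ^+ s * X (tabloid_act (tabloid_of a) (ext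
  s))).
  under eq_bigr do rewrite sum_ffunE mulr_suml.
  rewrite exchange_big /= big_imset /=; last by move=> ? ? _ _; apply: extI.
  apply: eq_big => [s|s _]; first by rewrite inE.
  have [_ _ ->] := extP s.
  rewrite (bigD1 (tabloid_act (tabloid_of a) (ext s))) //= big1 =>
    [|t /negPf tn].
    by rewrite ffunMzE ffunE eqxx addr0 -mulrzr intz mul1r.
  by rewrite ffunMzE ffunE tn mul0rz mul0r.
apply: eq_bigr => s _; rewrite tabloid_act_of XY behead_first_col;
  congr (_ * Y _).
apply: eq_ordseq => r; rewrite leg_act nth_first_col.
by have [-> _ _] := extP s.
Qed.

Definition row_match (w : seq nat) (t : tabloid) : bool :=
  [forall r : 'I_l, [exists k in val t (leg_row r), k.+1 == nth 0%N w r]].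

Lemma row_match_tab (a : tableau) w :
  row_match w (tabloid_of a) =
  [forall r : 'I_l, nth 0%N (behead (first_col a)) r == nth 0%N w r].
Proof.
apply: eq_forallb => r; rewrite behead_first_col nth_ordseq.
apply/exists_inP/idP => [[k]|aw]; first by rewrite rows_leg => /eqP ->.
by exists (leg a (lift ord0 r)); rewrite ?rows_leg.
Qed.

(* The value of u at the tabloid whose rows below the first one are w, and 0 if
   there is no such tabloid. *)
Definition tuple_val (u : {ffun tabloid -> int}) (w : seq nat) : int :=
  \sum_t u t * (row_match w t)%:R.

Lemma tuple_val_tab u (a : tableau) :
  tuple_val u (behead (first_col a)) = u (tabloid_of a).
Proof.
rewrite /tuple_val (bigD1 (tabloid_of a)) //= row_match_tab.
rewrite (_ : [forall _, _] = true) ?mulr1; last by apply/forallP.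
rewrite big1 ?addr0 // => t ta; case: (boolP (row_match _ t));
  last by rewrite mulr0.
move=> /forallP aw; case/eqP: ta; apply: tabloid_ofE => r.
have /exists_inP[k kt] := aw r.
by rewrite behead_first_col nth_ordseq eqSS => /eqP/val_inj <-.
Qed.

Lemma tuple_val_zmod_morphism w : zmod_morphism (tuple_val^~ w).
Proof.
move=> u v; rewrite /tuple_val -sumrB; apply: eq_bigr => t _.
by rewrite !ffunE mulrBl.
Qed.

(** The pairing agrees with the Leibniz formula term by term: the product of the entries below row 0
    indicates that the permuted leg is [w]. *)
Lemma tuple_val_polytabloidM a w :
  tuple_val (polytabloidM a) w = polytab_val l (first_col a) w.
Proof.
pose Y s := [forall r : 'I_l, nth 0%N s r == nth 0%N w r]%:R : int.
rewrite /tuple_val (@polytabloid_pairing a _ Y) => [|a'];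
  last by rewrite row_match_tab.
rewrite /polytab_val /determinant; apply: eq_bigr => s _; congr (_ * _).
rewrite big_ord_recl mxE unlift_none mul1r.
under eq_bigr do rewrite mxE liftK.
rewrite /Y; case: forallP => [E|/forallP].
  by rewrite big1 // => r _; have /eqP := E r; rewrite nth_ordseq => <-;
    rewrite eqxx.
rewrite negb_forall => /existsP[r]; rewrite nth_ordseq eq_sym => /negPf E.
by rewrite (bigD1 r) //= E mul0r.
Qed.

Lemma perm_form_polytabloidM a (v : {ffun tabloid -> int}) :
  perm_form (polytabloidM a) v = col_sum l (tuple_val v) (first_col a).
Proof. by apply: polytabloid_pairing => a'; rewrite tuple_val_tab. Qed.

Lemma polytabloidM_eq (a a' : tableau) :
  first_col a = first_col a' -> polytabloidM a = polytabloidM a'.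
Proof.
move=> aa'; apply/ffunP => t; have [b ->] := tabloidP t.
by rewrite -!tuple_val_tab !tuple_val_polytabloidM aa'.
Qed.

(** * Specht elements as alternating functions with vanishing sums *)

Lemma specht_ind (P : specht -> Prop) :
  (forall a, P (polytabloid a)) -> P 0 -> (forall u v, P u -> P v ->
    P (u - v)) ->
  forall u, P u.
Proof.
move=> Pa P0 PB u; have PN v : P v -> P (- v) by rewrite -sub0r; apply: PB.
have PD v w : P v -> P w -> P (v + w) by move=> Pv Pw; rewrite -[w]opprK;
    apply/PB/PN.
have PMn v k : P v -> P (v *+ k).
  by move=> Pv; elim: k => [|k IH]; rewrite ?mulr0n ?mulrS //; apply: PD.
have PM v (k : int) : P v -> P (v *~ k) by case: k => k Pv; [|apply: PN];
    apply: PMn.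
have /boolp.asboolP[c uE] := valP u.
suff -> : u = \sum_a polytabloid a *~ c a by elim/big_ind: _ => // a _;
    apply: PM.
apply: val_inj; rewrite raddf_sum uE; apply: eq_bigr => a _.
by rewrite raddfMz.
Qed.

Notation ev u := (tuple_val (val u)).

Lemma ev_zmod_morphism w : zmod_morphism (fun u : specht => ev u w).
Proof. by move=> u v; rewrite -tuple_val_zmod_morphism. Qed.

Lemma ev_alternating (u : specht) : alternating l (ev u).
Proof.
move=> s f; elim/specht_ind: u => [a||u v IHu IHv].
- by rewrite !tuple_val_polytabloidM; apply: polytab_val_alternating.
- by rewrite /tuple_val !big1 ?mulr0 // => t _; rewrite ffunE mul0r.
- by rewrite !ev_zmod_morphism IHu IHv mulrBr.
Qed.

Lemma ev_sumfree (u : specht) : sumfree l n (ev u).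
Proof.
move=> w sw; elim/specht_ind: u => [a||u v IHu IHv].
- under eq_bigr do rewrite tuple_val_polytabloidM.
  by apply: polytab_val_sumfree; rewrite ?size_first_col ?first_col_range.
- by rewrite big1 // => s _; rewrite /tuple_val big1 // => t _;
    rewrite ffunE mul0r.
- by under eq_bigr do rewrite ev_zmod_morphism; rewrite sumrB IHu IHv subrr.
Qed.

Lemma specht_eq0 (m : nat) (u : specht) : (0 < m <= n)%N ->
  (forall w, size w = l -> sorted ltn w ->
     all (fun i => 0 < i <= n)%N w -> m \notin w -> ev u w = 0) -> u = 0.
Proof.
move=> mn u0; have {}u0 := alternating_eq0 (ev_alternating u) (ev_sumfree u) mn
  u0.
apply: val_inj; apply/ffunP => t; have [a ->] := tabloidP t.
rewrite -tuple_val_tab u0 ?ffunE ?size_behead ?size_first_col //.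
by apply/allP => i /mem_behead; apply: (allP (first_col_range a)).
Qed.

Lemma specht_form_polytabloid a (v : specht) :
  specht_form (polytabloid a) v = col_sum l (ev v) (first_col a).
Proof. exact: perm_form_polytabloidM. Qed.

Lemma hook_polytabloidE (a : tableau) :
  hook_polytabloid n l (first_col a) = polytabloid a.
Proof.
rewrite /hook_polytabloid; case: pickP => [a'|/(_ a)];
  rewrite has_first_colE ?eqxx //.
by move=> /eqP/esym/polytabloidM_eq E; apply: val_inj.
Qed.

(** * Tableaux with prescribed first column; standard tableaux *)

Definition arm_letters (b : seq nat) : seq nat :=
    [seq k <- iota 1 n | k \notin b].

Definition good_col (b : seq nat) : bool :=
  [&& size b == l.+1, uniq b & all (fun i => 0 < i <= n)%N b].

Lemma size_arm_letters b : good_col b -> (size (arm_letters b)).+1 = (n - l)%N.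
Proof.
case/and3P => /eqP sb ub /allP rb.
have : perm_eq (b ++ arm_letters b) (iota 1 n).
  apply: uniq_perm => [||k]; last 1 first.
  - rewrite mem_cat mem_filter mem_iota add1n ltnS.
    by case: (boolP (k \in b)) => // /rb ->.
  - rewrite cat_uniq ub filter_uniq ?iota_uniq // andbT -all_predC.
    by apply/allP => k; rewrite mem_filter => /andP[].
  - exact: iota_uniq.
by move=> /perm_size; rewrite size_cat sb size_iota => E;
  rewrite -[X in (X - _)%N]E addSnnS addKn.
Qed.

Definition letter_at (b : seq nat) (c : cell sh) : nat :=
  if col_of c == 0 :> nat then nth 0%N b (row_of c)
  else nth 0%N (arm_letters b) (col_of c).-1.

Lemma letter_at_leg b j : letter_at b (leg_cell j) = nth 0%N b j.
Proof. by []. Qed.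

Lemma letter_at_arm b (j : 'I_(n - l)) : (0 < j)%N ->
  letter_at b (arm_cell j) = nth 0%N (arm_letters b) j.-1.
Proof. by rewrite /letter_at /col_of /= => /gtn_eqF ->. Qed.

Lemma letter_at_surj b k : good_col b -> (0 < k <= n)%N ->
    exists c, letter_at b c = k.
Proof.
move=> gb kn; have /and3P[/eqP sb ub _] := gb.
have [kb|kb] := boolP (k \in b).
  have kl : (index k b < l.+1)%N by rewrite -sb index_mem.
  by exists (leg_cell (Ordinal kl)); rewrite letter_at_leg nth_index.
have kb' : k \in arm_letters b by rewrite mem_filter kb mem_iota add1n ltnS.
have kl : ((index k (arm_letters b)).+1 < n - l)%N.
  by rewrite -(size_arm_letters gb) ltnS index_mem.
by exists (arm_cell (Ordinal kl)); rewrite letter_at_arm //= nth_index.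
Qed.

Lemma letter_at_notin b (j : 'I_(n - l)) : good_col b -> (0 < j)%N ->
  letter_at b (arm_cell j) \in arm_letters b.
Proof.
move=> gb jp; rewrite letter_at_arm // mem_nth //.
by rewrite -ltnS (size_arm_letters gb) prednK.
Qed.

Lemma letter_at_range b c : good_col b -> (0 < letter_at b c <= n)%N.
Proof.
move=> gb; have /and3P[/eqP sb ub /allP rb] := gb.
case: (cellP c) => [[j -> _]|[j -> jp]].
  by rewrite letter_at_leg rb // mem_nth // sb.
have := letter_at_notin gb jp; rewrite mem_filter mem_iota add1n ltnS.
by case/andP.
Qed.

Lemma letter_at_inj b : good_col b -> injective (letter_at b).
Proof.
move=> gb c c'; have /and3P[/eqP sb ub _] := gb.
have ua : uniq (arm_letters b) by rewrite filter_uniq ?iota_uniq.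
have no i (j : 'I_(n - l)) : (0 < j)%N ->
    letter_at b (leg_cell i) <> letter_at b (arm_cell j).
  move=> jp E; have := letter_at_notin gb jp;
    rewrite mem_filter -E letter_at_leg.
  by rewrite mem_nth ?sb.
case: (cellP c) (cellP c') => [[i -> _]|[i -> ip]] [[j -> _]|[j -> jp]] //.
- by rewrite !letter_at_leg => /eqP; rewrite nth_uniq ?sb // => /eqP/val_inj ->.
- by move/no => /(_ jp).
- by move/esym/no => /(_ ip).
rewrite !letter_at_arm // => /eqP; have sz := size_arm_letters gb.
rewrite nth_uniq // -1?ltnS ?sz ?prednK //.
by move=> E; congr arm_cell; apply: val_inj; move: E ip jp => /=; lia.
Qed.

Lemma exists_tableau b : good_col b -> exists a : tableau,
  forall c, entry a c = letter_at b c.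
Proof.
move=> gb; have rangeP c := letter_at_range c gb.
have lt_n c : ((letter_at b c).-1 < n)%N by have := rangeP c; lia.
pose f := [ffun c => Ordinal (lt_n c)].
have fE c : (val (f c)).+1 = letter_at b c.
  by rewrite ffunE /= prednK //; have /andP[] := rangeP c.
have fP : injectiveb f && [forall k, exists c, f c == k].
  apply/andP; split.
    by apply/injectiveP => c c' E; apply: (letter_at_inj gb); rewrite -!fE E.
  apply/forallP => k; have [|c cE] := @letter_at_surj b k.+1 gb;
    first exact: ltn_ord.
  by apply/existsP; exists c; rewrite -val_eqE -eqSS fE cE.
by exists (Sub f fP) => c; rewrite /entry SubK fE.
Qed.

Lemma first_col_letter_at b (a : tableau) : good_col b ->
  (forall c, entry a c = letter_at b c) -> first_col a = b.
Proof.
case/and3P => /eqP sb _ _ aE; rewrite -[RHS](ordseq_nth sb).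
by apply: eq_ordseq => j; rewrite -letter_at_leg -aE.
Qed.

Lemma good_colP b : good_col b -> exists a, first_col a = b.
Proof.
move=> gb; have [a aE] := exists_tableau gb.
by exists a; apply: first_col_letter_at.
Qed.

Lemma ev_hook b w : good_col b ->
  ev (hook_polytabloid n l b) w = polytab_val l b w.
Proof.
by move=> /good_colP[a <-]; rewrite hook_polytabloidE tuple_val_polytabloidM.
Qed.

Lemma specht_form_hook b (v : specht) : good_col b ->
  specht_form (hook_polytabloid n l b) v = col_sum l (ev v) b.
Proof.
by move=> /good_colP[a <-]; rewrite hook_polytabloidE specht_form_polytabloid.
Qed.

(** Anywhere but in the corner, the letter 1 would have to exceed the corner entry. *)
Lemma standard_first_col (a : tableau) : standard a ->
  sorted ltn (first_col a) /\ head 0%N (first_col a) = 1%N.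
Proof.
move=> /forallP sa; have {}sa c c' := andP (forallP (sa c) c').
have st : sorted ltn (first_col a).
  apply/(sortedP 0%N) => i; rewrite size_first_col => il.
  have il' := ltnW il.
  rewrite (nth_first_col a (Ordinal il)) (nth_first_col a (Ordinal il')).
  have [_ /implyP] := sa (leg_cell (Ordinal il')) (leg_cell (Ordinal il)).
  by apply; rewrite eqxx /row_of /=.
split=> //; rewrite -nth0 (nth_first_col a ord0).
have n0 : (0 < n)%N by exact: leq_ltn_trans ln.
have [c cE] := tableau_surj a (Ordinal n0).
case: (cellP c) cE => [[j -> _]|[j -> jp]] cE.
  case: (posnP j) => [j0|jp].
    by rewrite (_ : ord0 = j) ?/leg ?cE //; apply: val_inj; rewrite /= j0.
  have [_ /implyP] := sa (leg_cell ord0) (leg_cell j).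
  rewrite eqxx /row_of /= => /(_ jp).
  by rewrite /entry cE.
have [/implyP + _] := sa (leg_cell ord0) (arm_cell j).
rewrite -val_eqE /row_of /col_of /= jp => /(_ isT).
by rewrite /entry cE.
Qed.

(** The filling [letter_at] is standard: the arm letters are listed increasingly, and the corner
    holds 1, the smallest letter. *)
Lemma standard_exists b : good_col b -> sorted ltn b -> head 0%N b = 1%N ->
  exists2 a : tableau, standard a & first_col a = b.
Proof.
move=> gb st b1; have [a aE] := exists_tableau gb; exists a;
  last exact: first_col_letter_at.
have /and3P[/eqP sb ub _] := gb.
have leg_col k : col_of (leg_cell k) = Ordinal arm_gt0 by [].
have arm_col k : col_of (arm_cell k) = k by [].
apply/forallP => c; apply/forallP => c'; rewrite !aE.
case: (cellP c) (cellP c') => [[i -> _]|[i -> ip]] [[j -> _]|[j -> jp]].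
- rewrite !leg_col ltnn andbF eqxx /= !letter_at_leg; apply/implyP => ij.
  by apply: (sorted_ltn_nth ltn_trans); rewrite ?inE ?sb.
- rewrite leg_col arm_col -[Ordinal _ == _]val_eqE [val _ == _]ltn_eqF // andbT.
  apply/implyP => /andP[/eqP/(congr1 val) /= ij _].
  have := letter_at_notin gb jp; rewrite mem_filter mem_iota.
  have -> : letter_at b (leg_cell i) = 1%N by rewrite letter_at_leg ij nth0.
  case: (eqVneq (letter_at b (arm_cell j)) 1%N) => [->|]; last by lia.
  by rewrite -b1 -nth0 mem_nth ?sb.
- by rewrite leg_col arm_col ltn0 andbF -[_ == Ordinal _]val_eqE [val _ ==
    _]gtn_eqF.
- have -> : row_of (arm_cell i) = row_of (arm_cell j) by [].
  rewrite !arm_col ltnn andbF andbT eqxx /=; apply/implyP => ij.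
  rewrite !letter_at_arm //; apply: (sorted_ltn_nth ltn_trans).
  + by apply: sorted_filter (iota_ltn_sorted _ _); apply: ltn_trans.
  + by rewrite inE -ltnS (size_arm_letters gb) prednK.
  + by rewrite inE -ltnS (size_arm_letters gb) prednK.
  + by move: ij ip; lia.
Qed.

(** The first row, corner included, is the increasing list of the letters that do not occur below
    the corner, so the first column determines it. *)
Lemma standard_inj : {in @standard n sh &, injective first_col}.
Proof.
move=> a a' sa sa' E.
pose row (x : tableau) := ordseq (fun j : 'I_(n - l) => entry x (arm_cell j)).
have row_sorted x : standard x -> sorted ltn (row x).
  move=> /forallP sx; apply/(sortedP 0%N) => i; rewrite size_ordseq => il.
  have il' := ltnW il.
  rewrite (nth_ordseq _ (Ordinal il)) (nth_ordseq _ (Ordinal il')).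
  have /andP[/implyP + _] :=
      forallP (sx (arm_cell (Ordinal il'))) (arm_cell (Ordinal il)).
  by apply; rewrite eqxx /col_of /=.
have row_mem x k : (k \in row x)
    = (0 < k <= n)%N && (k \notin behead (first_col x)).
  rewrite behead_first_col; apply/mapP/andP => [[j _ ->]|[kn /mapP kx]].
    rewrite /entry ltn_ord; split=> //; apply/mapP => -[r _ /eqP].
    rewrite eqSS => /eqP/val_inj/tableau_inj/(congr1 (fun c => row_of c : nat)).
    by [].
  have kn' : (k.-1 < n)%N by lia.
  have [c /(congr1 val) /= cE] := tableau_surj x (Ordinal kn').
  have {}cE : k = entry x c by rewrite /entry cE prednK; case/andP: kn.
  case: (cellP c) cE => [[j -> _]|[j -> _]] cE; last by exists j;
    rewrite ?mem_enum.
  case: (unliftP ord0 j) cE => [r ->|->] cE.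
    by case: kx; exists r; rewrite ?mem_enum.
  have nl : (0 < n - l)%N by rewrite subn_gt0.
  exists (Ordinal nl); rewrite ?mem_enum // cE; congr (entry x _).
  by apply: val_inj; congr pair; apply: val_inj.
have rowE : row a = row a'.
  apply: (irr_sorted_eq ltn_trans ltnn); rewrite ?row_sorted // => k.
  by rewrite !row_mem E.
apply: val_inj; apply/ffunP => c; apply: val_inj; apply: succn_inj.
case: (cellP c) => [[j -> _]|[j -> _]].
  by have := congr1 (fun s => nth 0%N s j) E; rewrite !nth_first_col.
by have := congr1 (fun s => nth 0%N s j) rowE; rewrite !nth_ordseq.
Qed.

Lemma n_in_first_colE (a : tableau) : n_in_first_col a = (n \in first_col a).
Proof.
apply/existsP/mapP => [[c /andP[/eqP c0 /eqP nE]]|[j _ nE]].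
  case: (cellP c) c0 nE => [[j -> _] _ nE|[j -> jp]].
    by exists j; rewrite ?mem_enum -?[RHS]nE.
  by rewrite /col_of /= => j0; rewrite j0 in jp.
by exists (leg_cell j); apply/andP; split=> //; apply/eqP; exact: esym nE.
Qed.

End Hook.

(** * Trigonalization *)

(** A shift by 2 identifies these tuples with the strictly increasing tuples over ['I_(n - 2)],
    whose number is known. *)
Lemma incr_tuple_enum (n k : nat) : (2 <= n)%N ->
  exists s : seq (seq nat),
    [/\ uniq s, s =i incr_tuple n k & size s = binz (n%:Z - 2) k].
Proof.
move=> n2; pose f (t : k.-tuple 'I_(n - 2)) := [seq (val i).+2 | i <- t].
pose A := [set t : k.-tuple 'I_(n - 2) | sorted ltn (map val t)].
have fI : injective f.
  move=> t u /inj_map tu; apply: val_inj; apply: tu => i j /eqP.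
  by rewrite !eqSS => /eqP/val_inj.
exists (map f (enum A)); split.
- by rewrite map_inj_uniq ?enum_uniq.
- move=> b; rewrite unfold_in; apply/mapP/and3P => [[t + ->]|[/eqP sb ob rb]].
    rewrite mem_enum inE /f => ot; rewrite size_map size_tuple eqxx; split=> //.
      by rewrite (@map_comp _ _ _ (fun i => i.+2) val) sorted_map;
        apply: sub_sorted ot.
    by apply/allP => _ /mapP[i _ ->] /=; have := ltn_ord i; lia.
  have sb' : size b = k by case: sb.
  pose c : seq 'I_(n - 2) := pmap insub [seq (i - 2)%N | i <- b].
  have cE : map val c = [seq (i - 2)%N | i <- b].
    rewrite /c pmap_filter; last exact: insubK.
    apply/all_filterP/allP => _ /mapP[i ib ->]; rewrite isSome_insub.
    by have := allP rb i ib; lia.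
  have sc : size c == k by rewrite -(size_map val) cE size_map sb'.
  have bE : b = [seq i.+2 | i <- map val c].
    rewrite cE -map_comp -[LHS]map_id; apply/eq_in_map => i ib /=.
    by have := allP rb i ib; lia.
  exists (Tuple sc); last by rewrite {1}bE -map_comp.
  rewrite mem_enum inE /=; move: ob; rewrite bE sorted_map.
  by apply: sub_sorted.
(* Outside the range tested by [binz] one has [k > n - 2], where the binomial coefficient is zero as
   well. *)
rewrite size_map -cardE card_ltn_sorted_tuples /binz; case: ifP;
  last by move=> *; rewrite bin_small //; lia.
by move=> _; congr 'C(_, _); lia.
Qed.

(** For [l = 0] the length is -1: there is no tuple, and [binz] is 0. *)
Lemma incr_tuple_pred_enum (n l : nat) : (2 <= n)%N ->
  exists s : seq (seq nat),
    [/\ uniq s, s =i incr_tuple n (l%:Z - 1) & size s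
      = binz (n%:Z - 2) (l%:Z - 1)].
Proof.
move=> n2; case: l => [|l].
  exists [::]; split=> // b; rewrite in_nil unfold_in; case: eqP => //; lia.
have -> : l.+1%:Z - 1 = l%:Z by lia.
exact: incr_tuple_enum.
Qed.

(** * The two bases [x] and [y] *)

Section Assembly.
Variables n l : nat.
Hypotheses (hn : (2 <= n)%N) (ln : (l < n)%N).

Notation sh := (hook n l).
Notation specht := (specht n sh).
Notation hp := (hook_polytabloid n l).
Notation ev u := (tuple_val (val u)).
Notation form := (@specht_form n sh).

Lemma specht_formBl (v : specht) : zmod_morphism (form^~ v).
Proof.
move=> u w; rewrite /specht_form /perm_form -sumrB; apply: eq_bigr => t _.
by rewrite !ffunE mulrBl.
Qed.

Variables bs ds : seq (seq nat).
Hypotheses (ubs : uniq bs) (bsE : bs =i incr_tuple n l)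
           (uds : uniq ds) (dsE : ds =i incr_tuple n (l%:Z - 1)).

Let y1 := [seq hp (1%N :: b) | b <- bs].
Let y2 := [seq hp (1%N :: rcons d n) | d <- ds].
Let x1 := [seq hp (n :: b) | b <- bs].
Let x2 := [seq \sum_(1 <= s < n | s \notin d) hp (s :: rcons d n) | d <- ds].

(** The parts below the corner of the first columns of standard tableaux, those without [n] first;
    evaluation at them is dual to [y]. *)
Definition std_legs : seq (seq nat) := bs ++ [seq rcons d n | d <- ds].
Let cs := std_legs.

Lemma bsP b : b \in bs ->
  [/\ size b = l, sorted ltn b & forall i, i \in b -> (1 < i < n)%N].
Proof.
rewrite bsE unfold_in => /and3P[/eqP sb ob /allP rb]; split=> //;
  first by case: sb.
by move=> i /rb; lia.
Qed.

Lemma dsP d : d \in ds ->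
  [/\ (size d).+1 = l, sorted ltn d & forall i, i \in d -> (1 < i < n)%N].
Proof.
rewrite dsE unfold_in => /and3P[/eqP sb ob /allP rb]; split=> //.
  by apply/eqP; rewrite -eqz_nat -addn1 PoszD sb subrK.
by move=> i /rb; lia.
Qed.

Lemma std_legs_uniq : uniq cs.
Proof.
rewrite cat_uniq ubs map_inj_uniq ?uds; last exact: rcons_injl.
rewrite andbT; apply/hasPn => _ /mapP[d _ ->]; apply/negP => /bsP[_ _ /(_ n)].
by rewrite mem_rcons mem_head ltnn andbF => /(_ isT).
Qed.

Lemma mem_std_legs c : c \in cs =
  [&& size c == l, sorted ltn c & all (fun i => 1 < i <= n)%N c].
Proof.
rewrite mem_cat; apply/orP/and3P =>
  [[/bsP[sb ob rb]|/mapP[d /dsP[sd od rd] ->]]|].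
- split=> //; first exact/eqP.
  by apply/allP => i /rb; lia.
- split; first by rewrite size_rcons; apply/eqP.
    case: d sd od rd => //= x d sd od rd; rewrite rcons_path od /=.
    by have := rd (last x d) (mem_last _ _); lia.
  by rewrite all_rcons leqnn hn /=; apply/allP => i /rd; lia.
move=> [/eqP sc oc /allP rc]; have [nc|nc] := boolP (n \in c); last first.
  left; rewrite bsE unfold_in; apply/and3P; split=> //; first by rewrite sc.
  apply/allP => i ic; have := rc i ic;
    have : i != n by apply: contraNneq nc => <-.
  by lia.
(* In an increasing tuple bounded by [n], the letter [n] can only be last. *)
right; case/lastP: c nc oc rc sc => // d k nc oc rc sc.
rewrite size_rcons in sc.
have dk i : i \in d -> (i < k)%N.
  move: oc; rewrite -cats1 (sorted_pairwise ltn_trans) pairwise_cat allrel1r.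
  by case/and3P => /allP dk _ _ /dk.
have kn : k = n.
  have := rc k; rewrite mem_rcons mem_head => /(_ isT) kn.
  move: nc; rewrite mem_rcons inE => /orP[/eqP //|/dk]; lia.
apply/mapP; exists d; last by rewrite kn.
rewrite dsE unfold_in; apply/and3P; split.
    by rewrite -sc -addn1 PoszD addrK.
  by move: oc; rewrite -cats1 !(sorted_pairwise ltn_trans) pairwise_cat =>
    /and3P[].
apply/allP => i id; have := dk i id; have := rc i;
  rewrite mem_rcons inE id orbT => /(_ isT).
by lia.
Qed.

Lemma legP c : c \in cs ->
  [/\ size c = l, sorted ltn c & forall i, i \in c -> (1 < i <= n)%N].
Proof. by rewrite mem_std_legs => /and3P[/eqP sc oc /allP rc]. Qed.

Lemma good_col_cons m c : sorted ltn c -> size c = l -> (0 < m <= n)%N ->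
    m \notin c ->
  (forall i, i \in c -> (0 < i <= n)%N) -> good_col n l (m :: c).
Proof.
move=> oc sc mn mc rc; rewrite /good_col /= sc eqxx mc mn /=.
by move: oc; rewrite ltn_sorted_uniq_leq => /andP[-> _]; apply/allP.
Qed.

Lemma good_col_leg c : c \in cs -> good_col n l (1%N :: c).
Proof.
move=> /legP[sc oc rc]; apply: good_col_cons => //; first by lia.
  by apply/negP => /rc.
by move=> i /rc; lia.
Qed.

Lemma good_col_bs b : b \in bs -> good_col n l (n :: b).
Proof.
move=> /bsP[sb ob rb]; apply: good_col_cons => //; first by lia.
  by apply/negP => /rb; lia.
by move=> i /rb; lia.
Qed.

Lemma good_col_ds s d : d \in ds -> s \notin d -> (0 < s < n)%N ->
  good_col n l (s :: rcons d n).
Proof.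
move=> dd sd sn; have dc : rcons d n \in cs by rewrite mem_cat (map_f (rcons^~
  n) dd) orbT.
have [sz od rd] := legP dc; apply: good_col_cons => //; first by lia.
  by rewrite mem_rcons inE negb_or sd andbT; lia.
by move=> i /rd; lia.
Qed.

Let yE : y1 ++ y2 = [seq hp (1%N :: c) | c <- cs].
Proof. by rewrite map_cat -map_comp. Qed.

Lemma ev_std c w : c \in cs -> w \in cs -> ev (hp (1%N :: c)) w = (c == w)%:R.
Proof.
move=> cc cw; rewrite ev_hook ?good_col_leg //.
have [sc oc rc] := legP cc; have [sw ow rw] := legP cw.
by apply: polytab_val_cons => //; apply/negP; [move/rc|move/rw].
Qed.

Lemma Zbasis_std : Zbasis (y1 ++ y2).
Proof.
rewrite yE; apply: (@Zbasis_dual _ _ (fun i u => ev u (nth [::] cs i))) =>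
  [i|i j|v v0].
- exact: ev_zmod_morphism.
- rewrite size_map => il jl; rewrite (nth_map [::]) // ev_std ?mem_nth //.
  by rewrite nth_uniq ?std_legs_uniq // eq_sym.
apply: (specht_eq0 ln (m := 1%N)) => [|w sw ow rw w1]; first by lia.
have cw : w \in cs.
  rewrite mem_std_legs sw ow eqxx; apply/allP => i iw; have := allP rw i iw.
  have : i != 1%N by apply: contraNneq w1 => <-.
  by lia.
have := v0 (index w cs); rewrite size_map index_mem nth_index //; exact.
Qed.

Let X2 d := \sum_(1 <= s < n | s \notin d) hp (s :: rcons d n).

Lemma ev_hook_n b w : b \in bs -> size w = l -> sorted ltn w -> n \notin w ->
  ev (hp (n :: b)) w = (b == w)%:R.
Proof.
move=> bb sw ow nw; rewrite ev_hook ?good_col_bs //; have [sb ob rb] := bsP bb.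
by apply: polytab_val_cons => //; apply/negP => /rb; rewrite ltnn andbF.
Qed.

Lemma ds_cons d : d \in ds ->
  [/\ size (1%N :: d) = l, sorted ltn (1%N :: d) & n \notin 1%N :: d].
Proof.
move=> /dsP[sd od rd]; split=> //.
  by rewrite /= (path_sortedE ltn_trans) od andbT; apply/allP => i /rd /andP[].
by rewrite inE gtn_eqF //; apply/negP => /rd; rewrite ltnn andbF.
Qed.

(** A summand with [s > 1] lacks the letter 1 in its column and vanishes. For [s = 1] the column is
    [(1, d)] followed by [n], and the final position of [n] produces the sign. *)
Lemma ev_hook_sum d d' : d \in ds -> d' \in ds ->
  ev (X2 d) (1%N :: d') = (-1) ^+ l * (d == d')%:R.
Proof.
move=> dd dd'; have [sd od rd] := dsP dd; have [sd' od' rd'] := dsP dd'.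
have l_gt0 : (0 < l)%N by rewrite -sd.
have d1 : 1%N \notin d by apply/negP => /rd.
have d1' : 1%N \notin d' by apply/negP => /rd'.
rewrite (zmod_morphism_bigsum _ _ _ (ev_zmod_morphism _)) big_ltn_cond // d1.
rewrite big_nat_cond big1 ?addr0 => [|s /andP[/andP[s2 sn] sd0]]; last first.
  rewrite ev_hook ?good_col_ds // ?sn ?(ltnW s2) //.
  apply: (@polytab_val_notin l _ _ (Ordinal l_gt0));
    first by rewrite /= size_rcons sd.
  by rewrite /= inE mem_rcons inE !negb_or d1 andbT; lia.
have [sc oc nc] := ds_cons dd; have [sc' oc' nc'] := ds_cons dd'.
by rewrite ev_hook ?good_col_ds // -rcons_cons polytab_val_rcons // eqseq_cons.
Qed.

Lemma specht_form_hook_n b (u : specht) : b \in bs ->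
  form (hp (n :: b)) u = l`!%:Z * \sum_(i < l.+1) (-1) ^+ i * ev u (omit (n ::
    b) i).
Proof.
move=> bb; rewrite specht_form_hook ?good_col_bs // col_sum_omit ?natz //.
exact: ev_alternating.
Qed.

Lemma specht_form_hook_n_std b c : b \in bs -> c \in bs ->
  form (hp (n :: b)) (hp (1%N :: c)) = (b == c)%:R * l`!%:Z.
Proof.
move=> bb cb; have [sb ob rb] := bsP bb; have [sc oc rc] := bsP cb.
have cc : c \in cs by rewrite mem_cat cb.
have bc : b \in cs by rewrite mem_cat bb.
rewrite specht_form_hook_n // big_ord_recl expr0 mul1r omit0 /= ?sb //.
rewrite ev_std // big1 ?addr0 => [|i _]; first by rewrite eq_sym mulrC.
(* Deleting a letter of [b] leaves [n] in front, and [n] is not in the column [1 :: c]. The index 0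
   lies in ['I_l] because [i] does. *)
rewrite ev_hook ?good_col_leg // (@polytab_val_notin l _ _ (Ordinal
  (leq_ltn_trans (leq0n i) (ltn_ord i)))) ?mulr0 //=.
  by rewrite sc.
rewrite (nth_ordseq _ (Ordinal (leq_ltn_trans (leq0n i) (ltn_ord i)))) /= inE
  negb_or.
by apply/andP; split; [lia | apply/negP => /rc; rewrite ltnn andbF].
Qed.

(** The sum may be extended to all [s] in [1, n]: for [s] in [d] or [s = n] the column repeats a
    letter and contributes zero. Then [sum_col_sum] applies. *)
Lemma specht_form_hook_sum d (u : specht) : d \in ds ->
  form (X2 d) u = (n * l`!)%:Z * ev u (rcons d n).
Proof.
move=> dd; have [sd od rd] := dsP dd.
rewrite (zmod_morphism_bigsum _ _ _ (specht_formBl _)).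
rewrite -natz -(sum_col_sum (ev_alternating ln u) (ev_sumfree ln u))
  ?size_rcons //.
rewrite [RHS]big_nat_recr /=; last by lia.
rewrite [X in _ = _ + X]col_sum_nuniq ?addr0; last first.
- by rewrite /= mem_rcons mem_head.
- by rewrite /= size_rcons sd.
rewrite big_mkcond; apply: eq_big_nat => s /andP[s1 sn].
case: ifP => sd0; first by rewrite specht_form_hook ?good_col_ds // s1.
rewrite col_sum_nuniq //=; first by rewrite size_rcons sd.
by rewrite mem_rcons inE (negbFE sd0) orbT.
Qed.

(** The increasing tuples avoiding [n] are those in [bs] and the [(1, d)], which makes their
    evaluations separating. The pairing is block triangular: [x1] vanishes at the [(1, d)], as no
    [b] contains 1. *)
Lemma Zbasis_hook : Zbasis (x1 ++ x2).
Proof.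
(* The factor [(-1) ^+ l] undoes the sign in [ev_hook_sum]. *)
apply: (@Zbasis_block_dual _ _ _ (fun i u => ev u (nth [::] bs i))
         (fun i u => (-1) ^+ l * ev u (1%N :: nth [::] ds i))).
- by move=> i; apply: ev_zmod_morphism.
- by move=> i u v; rewrite ev_zmod_morphism mulrBr.
- move=> i j; rewrite !size_map => il jl; rewrite (nth_map [::]) //.
  have [sb ob rb] := bsP (mem_nth [::] il).
  rewrite ev_hook_n ?mem_nth // ?nth_uniq // 1?eq_sym //.
  by apply/negP => /rb; rewrite ltnn andbF.
- move=> i j; rewrite !size_map => il jl; rewrite (nth_map [::]) //.
  have [sc oc nc] := ds_cons (mem_nth [::] il).
  rewrite ev_hook_n ?mem_nth //; have [_ _ rb] := bsP (mem_nth [::] jl).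
  case: eqP => [E|]; last by rewrite mulr0.
  by have := rb 1%N; rewrite E mem_head => /(_ isT).
- move=> i j; rewrite !size_map => il jl; rewrite (nth_map [::]) //.
  by rewrite ev_hook_sum ?mem_nth // nth_uniq // mulrA -expr2 sqrr_sign mul1r
    eq_sym.
move=> v v1 v2; apply: (specht_eq0 ln (m := n)) => [|w sw ow rw wn];
  first by lia.
have rw' i : i \in w -> (0 < i < n)%N.
  move=> iw; have := allP rw i iw.
  have : i != n by apply: contraNneq wn => <-.
  by lia.
have [w1|w1] := boolP (1%N \in w); last first.
  have bw : w \in bs.
    rewrite bsE unfold_in; apply/and3P; split; [by rewrite sw | by [] | ].
    apply/allP => i iw; have := rw' i iw.
    have : i != 1%N by apply: contraNneq w1 => <-.
    by lia.
  by have := v1 (index w bs); rewrite size_map index_mem nth_index //; apply.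
(* Being increasing, a tuple that contains 1 starts with it. *)
case: w sw ow {rw} wn rw' w1 => // i d sd od wn rw' w1.
have {}od : all (ltn i) d && sorted ltn d by rewrite -(path_sortedE ltn_trans).
have /andP[/allP id od'] := od.
have i1 : i = 1%N.
  move: w1; rewrite inE => /orP[/eqP //|/id /=].
  by have := rw' i (mem_head _ _); lia.
rewrite {}i1 in sd wn rw' w1 id *.
have dd : d \in ds.
  rewrite dsE unfold_in; apply/and3P; split=> //.
    by rewrite -sd /= -[(size d).+1]addn1 PoszD addrK.
  apply/allP => j jd; have := id j jd; have := rw' j;
    rewrite inE jd orbT /= => /(_ isT).
  by lia.
have := v2 (index d ds); rewrite size_map index_mem nth_index // => /(_ dd)/eqP.
by rewrite mulf_eq0 signr_eq0 => /eqP.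
Qed.

(** * The matrix of the form between [x] and [y], and the cokernel *)

Let k1 := size bs.
Let k2 := size ds.

Let size_cs : size cs = (k1 + k2)%N.
Proof. by rewrite size_cat size_map. Qed.

Let nth_x1 i : (i < k1)%N -> (x1 ++ x2)`_i = hp (n :: nth [::] bs i).
Proof. by move=> il; rewrite nth_cat size_map il (nth_map [::]). Qed.

Let nth_x2 i : (i < k2)%N -> (x1 ++ x2)`_(k1 + i) = X2 (nth [::] ds i).
Proof. by move=> il; rewrite nth_cat size_map ltnNge leq_addr /= addKn (nth_map
  [::]). Qed.

Let nth_y i : (i < size cs)%N -> (y1 ++ y2)`_i = hp (1%N :: nth [::] cs i).
Proof. by move=> il; rewrite yE (nth_map [::]). Qed.

Let nth_cs1 i : (i < k1)%N -> nth [::] cs i = nth [::] bs i.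
Proof. by move=> il; rewrite nth_cat il. Qed.

Let nth_cs2 i : (i < k2)%N -> nth [::] cs (k1 + i) = rcons (nth [::] ds i) n.
Proof.
by move=> il; rewrite nth_cat ltnNge leq_addr /= addKn (nth_map [::]).
Qed.

Let form11 i j : (i < k1)%N -> (j < k1)%N ->
  form (x1 ++ x2)`_i (y1 ++ y2)`_j = (i == j)%:R * l`!%:Z.
Proof.
move=> il jl; rewrite nth_x1 // nth_y ?size_cs ?ltn_addr // nth_cs1 //.
by rewrite specht_form_hook_n_std ?mem_nth // nth_uniq.
Qed.

(** The factor l! from [col_sum_omit] gives the divisibility above the diagonal. *)
Let form12 i j : (i < k1)%N -> exists a,
  form (x1 ++ x2)`_i (y1 ++ y2)`_j = l`!%:Z * a.
Proof.
by move=> il; rewrite nth_x1 // specht_form_hook_n ?mem_nth //; eexists.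
Qed.

Let form2 i j : (i < k2)%N -> (j < k1 + k2)%N ->
  form (x1 ++ x2)`_(k1 + i) (y1 ++ y2)`_j = (k1 + i == j)%N%:R * (n * l`!)%:Z.
Proof.
move=> il jl; rewrite nth_x2 // specht_form_hook_sum ?mem_nth // mulrC.
have il' : (k1 + i < size cs)%N by rewrite size_cs ltn_add2l.
rewrite nth_y ?size_cs // -nth_cs2 // ev_std ?mem_nth // ?size_cs //.
by rewrite nth_uniq ?std_legs_uniq // ?size_cs // eq_sym.
Qed.

Lemma trigonalizes_hook : trigonalizes form (x1 ++ x2) (y1 ++ y2).
Proof.
have szy : size (y1 ++ y2) = (k1 + k2)%N by rewrite size_cat !size_map.
have fact0 : l`!%:Z != 0 by rewrite -lt0n fact_gt0.
have nfact0 : (n * l`!)%:Z != 0 by rewrite -lt0n muln_gt0 fact_gt0; lia.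
have split_ix i : (k1 <= i)%N -> (i < k1 + k2)%N ->
    exists2 i', i = (k1 + i')%N & (i' < k2)%N.
  by exists (i - k1)%N; rewrite ?subnKC // ltn_subLR.
have diag1 i : (i < k1)%N -> form (x1 ++ x2)`_i (y1 ++ y2)`_i = l`!%:Z.
  by move=> il; rewrite form11 // eqxx mul1r.
have diag2 i : (i < k2)%N ->
    form (x1 ++ x2)`_(k1 + i) (y1 ++ y2)`_(k1 + i) = (n * l`!)%:Z.
  by move=> il; rewrite form2 ?ltn_add2l // eqxx mul1r.
apply: trigonalizesI; rewrite ?szy.
- exact: specht_formBl.
- exact: Zbasis_hook.
- exact: Zbasis_std.
- by rewrite size_cat !size_map.
- move=> i im; case: (ltnP i k1) => [il|]; first by rewrite diag1.
  by move=> /split_ix/(_ im)[i' -> il]; rewrite diag2.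
- move=> i j /andP[ji im]; case: (ltnP i k1) => [il|].
    by rewrite form11 ?(ltn_trans ji) // gtn_eqF // mul0r.
  move=> /split_ix/(_ im)[i' iE il]; rewrite iE in ji im *.
  by rewrite form2 ?(ltn_trans ji) // gtn_eqF // mul0r.
- move=> i j /andP[ij jm]; have im := ltn_trans ij jm.
  case: (ltnP i k1) => [il|].
    by rewrite diag1 //; have [a ->] := form12 j il; apply: dvdz_mulr.
  move=> /split_ix/(_ im)[i' iE il]; rewrite iE in ij *.
  by rewrite [form _ (_`_j)]form2 // ltn_eqF // mul0r dvdz0.
- move=> i im; case: (ltnP i.+1 k1) => [il|].
    by rewrite !diag1 // ltnW.
  move=> /split_ix/(_ im)[j jE jl]; rewrite jE diag2 //.
  case: (ltnP i k1) => [il|].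
    by rewrite diag1 // PoszM dvdz_mull.
  by move=> /split_ix/(_ (ltnW im))[i' -> il]; rewrite diag2.
Qed.

(** Evaluations at the standard legs form the dual basis of [y], and [A] is the upper right block
    divided by l!. *)
Lemma dual_quotient_iso : zmod_iso (dual_quotient n sh)
  ({ffun 'I_k1 -> Zquot l`!} * {ffun 'I_k2 -> Zquot (n * l`!)})%type.
Proof.
have /boolp.choice[A AE] (ij : 'I_k1 * 'I_k2) :=
    form12 (k1 + ij.2) (ltn_ord ij.1).
pose y := y1 ++ y2; pose x := x1 ++ x2.
have i1 (i : 'I_k1) : (i < size cs)%N by rewrite size_cs ltn_addr.
have i2 (i : 'I_k2) : (k1 + i < size cs)%N by rewrite size_cs ltn_add2l.
have csE i j : (i < size cs)%N -> (j < size cs)%N ->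
    ev y`_j (nth [::] cs i) = (i == j)%:R.
  move=> il jl; rewrite nth_y // ev_std ?mem_nth //.
  by rewrite nth_uniq ?std_legs_uniq // eq_sym.
have span (z1 z2 : seq specht) : size z1 = k1 -> size z2 = k2 ->
    Zbasis (z1 ++ z2) ->
    forall v, exists c1 c2, v = \sum_(i < k1) (z1 ++ z2)`_i *~ c1 i
                              + \sum_(i < k2) (z1 ++ z2)`_(k1 + i) *~ c2 i.
  move=> z1k z2k zb v; have [c1 [c2 ->]] := Zbasis_cat_span v zb z1k z2k.
  exists c1, c2; congr (_ + _); apply: eq_bigr => i _; rewrite nth_cat z1k.
    by rewrite ltn_ord.
  by rewrite ltnNge leq_addr /= addKn.
apply: (@dvdz_coker_iso_block _ _ k1 k2 l`! (n * l`!)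
  (fun i => x`_i) (fun i => y`_i) (fun i => x`_(k1 + i)) (fun i => y`_(k1 + i))
  (fun i u => ev u (nth [::] cs i)) (fun i u => ev u (nth [::] cs (k1 + i)))
  (fun i j => A (i, j))).
- by move=> i; apply: ev_zmod_morphism.
- by move=> i; apply: ev_zmod_morphism.
- by move=> i j; rewrite csE.
- by move=> i j; rewrite csE // ltn_eqF // ltn_addr.
- by move=> i j; rewrite csE // gtn_eqF // ltn_addr.
- by move=> i j; rewrite csE // eqn_add2l.
- by move=> i j; apply: form11.
- by move=> i j; apply: (AE (i, j)).
- by move=> i j; rewrite [LHS]form2 ?ltn_addr // gtn_eqF ?mul0r // ltn_addr.
- by move=> i j; rewrite [LHS]form2 ?ltn_add2l // eqn_add2l.
- by apply: span; rewrite ?size_map //; apply: Zbasis_hook.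
- by apply: span; rewrite ?size_map //; apply: Zbasis_std.
Qed.

(** * Standard tableaux in an arbitrary admissible order *)

Lemma standard_leg (a : tableau n sh) : standard a ->
  exists2 c, c \in cs & first_col ln a = 1%N :: c.
Proof.
move=> /(standard_first_col ln); have := first_col_range ln a.
have := size_first_col ln a;
    case: first_col => // i c [sc] /= /andP[_ rc] [oc i1].
exists c; last by rewrite i1.
move: oc; rewrite (path_sortedE ltn_trans) => /andP[/allP ic oc].
rewrite mem_std_legs oc sc eqxx; apply/allP => j jc.
by have := allP rc j jc; have := ic j jc; rewrite /= i1; lia.
Qed.

Lemma leg_standard c : c \in cs ->
  exists2 a : tableau n sh, standard a & first_col ln a = 1%N :: c.
Proof.
move=> cc; apply: standard_exists; rewrite ?good_col_leg //=.
have [_ oc rc] := legP cc; rewrite (path_sortedE ltn_trans) oc andbT.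
by apply/allP => i /rc /andP[].
Qed.

(** The order inside each block of [T] is arbitrary, so the lists indexing [x] have to be read off
    from [T] to keep diagonal correspondents aligned. *)
Lemma std_ordering_legs (T : seq (tableau n sh)) : std_ordering T ->
  exists bs' ds', [/\ uniq bs' /\ bs' =i bs, uniq ds' /\ ds' =i ds &
    [seq polytabloid a | a <- T] =
    [seq hp (1%N :: b) | b <- bs'] ++ [seq hp (1%N :: rcons d n) | d <- ds']].
Proof.
case=> uT TE ordT; pose c a := behead (first_col ln a).
pose hasn a := n \in c a.
have cP a : a \in T -> c a \in cs /\ first_col ln a = 1%N :: c a.
  by rewrite TE => /standard_leg[c' cc']; rewrite /c => ->.
(* No tableau with [n] in its first column precedes one without, so the two filters concatenate to
   [T]. *)
have Tsplit : T = [seq a <- T | ~~ hasn a] ++ [seq a <- T | hasn a].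
  have : pairwise (fun a a' => hasn a ==> hasn a') T.
    rewrite -(@eq_in_pairwise _ (mem T) (fun a a' =>
      n_in_first_col a ==> n_in_first_col a')) ?allss //.
    move=> a a' /cP[_ E] /cP[_ E'].
    by rewrite !(n_in_first_colE ln) E E' !inE !gtn_eqF.
  elim: (T) => //= a s IHs /andP[/allP aT] /IHs E.
  case: (boolP (hasn a)) => /= na; last by rewrite -E.
  have sT : all hasn s by apply/allP => a' /aT; rewrite na.
  rewrite (eq_in_filter (a2 := pred0)) ?filter_pred0;
    last by move=> b /(allP sT) ->.
  by rewrite (all_filterP sT).
have c_inj : {in T &, injective c}.
  move=> a a' aT aT' E; apply: (@standard_inj _ _ ln); rewrite -?TE //.
  by rewrite (cP a aT).2 (cP a' aT').2 E.
have memT c' : c' \in cs -> exists2 a, a \in T & c a = c'.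
  by case/leg_standard => a sa E; exists a; rewrite ?TE // /c E.
have bsn b : b \in bs -> n \notin b.
  by move=> /bsP[_ _ rb]; apply/negP => /rb; rewrite ltnn andbF.
(* Keeping [l.-1] letters drops the final [n]. *)
pose dc a := take l.-1 (c a).
have dcP a : a \in T -> hasn a -> c a = rcons (dc a) n /\ dc a \in ds.
  move=> /cP[+ _] na; rewrite mem_cat => /orP[/bsn|/mapP[d dd E]].
    by rewrite -/(hasn a) na.
  have [sd _ _] := dsP dd.
  have -> : dc a = d by rewrite /dc E -sd -cats1 take_size_cat.
  by rewrite E.
exists [seq c a | a <- T & ~~ hasn a], [seq dc a | a <- T & hasn a]; split.
- split.
    rewrite map_inj_in_uniq ?filter_uniq // => a a'.
    by rewrite !mem_filter => /andP[_ aT] /andP[_ aT']; apply: c_inj.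
  move=> b; apply/mapP/idP => [[a + ->]|bb].
    rewrite mem_filter => /andP[na /cP[+ _]];
      rewrite mem_cat => /orP[//|/mapP[d _ E]].
    by rewrite /hasn E mem_rcons mem_head in na.
  have [|a aT E] := memT b; first by rewrite mem_cat bb.
  by exists a; rewrite ?mem_filter ?aT ?andbT // /hasn E bsn.
- split.
    rewrite map_inj_in_uniq ?filter_uniq // => a a'.
    rewrite !mem_filter => /andP[na aT] /andP[na' aT'] E; apply: c_inj => //.
    by rewrite (dcP a aT na).1 (dcP a' aT' na').1 E.
  move=> d; apply/mapP/idP => [[a + ->]|dd].
    by rewrite mem_filter => /andP[na aT]; apply: (dcP a aT na).2.
  have [|a aT E] := memT (rcons d n).
    by rewrite mem_cat (map_f (rcons^~ n) dd) orbT.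
  have na : hasn a by rewrite /hasn E mem_rcons mem_head.
  exists a; rewrite ?mem_filter ?aT ?na //.
  by apply: (@rcons_injl _ n); rewrite -(dcP a aT na).1 E.
rewrite {1}Tsplit map_cat -!map_comp; congr (_ ++ _).
  apply/eq_in_map => a; rewrite mem_filter => /andP[na aT] /=.
  by rewrite -(cP a aT).2 hook_polytabloidE.
apply/eq_in_map => a; rewrite mem_filter => /andP[na aT] /=.
by rewrite -(dcP a aT na).1 -(cP a aT).2 hook_polytabloidE.
Qed.
End Assembly.

Unset Implicit Arguments.

Theorem theorem5p5 (n l : nat) (hn : (2 <= n)%N) (hl : (l <= n - 1)%N) :
  zmod_iso (dual_quotient n (hook n l))
    ({ffun 'I_(binz (n%:Z - 2) l) -> Zquot l`!} *
     {ffun 'I_(binz (n%:Z - 2) (l%:Z - 1)) -> Zquot (n * l`!)})%type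
  /\
  forall T : seq (tableau n (hook n l)), std_ordering T ->
  exists bs ds : seq (seq nat),
    let y := [seq polytabloid a | a <- T] in
    let x := [seq hook_polytabloid n l (n :: b) | b <- bs] ++
             [seq \sum_(1 <= s < n | s \notin d)
                    hook_polytabloid n l (s :: rcons d n) | d <- ds] in
    [/\ uniq bs /\ bs =i incr_tuple n l,
        uniq ds /\ ds =i incr_tuple n (l%:Z - 1),
        y = [seq hook_polytabloid n l (1%N :: b) | b <- bs] ++
            [seq hook_polytabloid n l (1%N :: rcons d n) | d <- ds],
        Zbasis x /\ Zbasis y
      & trigonalizes (@specht_form n (hook n l)) x y].
Proof.
have ln : (l < n)%N by lia.
have [bs [ubs bsE sbs]] := incr_tuple_enum l hn.
have [ds [uds dsE sds]] := incr_tuple_pred_enum l hn.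
split; first by rewrite -sbs -sds; apply: dual_quotient_iso.
(* The index lists are rearranged in the order prescribed by [T]; the two bases and the
   trigonalization are available for any enumeration. *)
move=> T ordT; have [bs' [ds' [[ubs' bsE'] [uds' dsE'] yE]]] :=
  std_ordering_legs hn ln ubs bsE uds dsE ordT.
have bsI : bs' =i incr_tuple n l by move=> b; rewrite bsE' bsE.
have dsI : ds' =i incr_tuple n (l%:Z - 1) by move=> d; rewrite dsE' dsE.
exists bs', ds'; rewrite /= yE; split=> //.
  by split; [apply: Zbasis_hook | apply: Zbasis_std].
exact: trigonalizes_hook.
Qed.
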